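(* Let $\zeta\in\mathbb{C}\setminus\mathbb{R}$ be a $q$-th root of unity ($q>2$) and let $\beta>1$ be a Pisot number. Let $\eta_1,\eta_2,\xi\in\mathbb{Q}(\zeta,\beta)$ with $\eta_1/\eta_2\notin\mathbb{R}$, and let $T:\mathcal{X}\to\mathcal{X}$ be the associated rotational beta transformation. If $\zeta+\zeta^{-1}\in\mathbb{Q}(\beta)$, then the system $(\mathcal{X},T)$ is sofic.
   Context: Let $\mathcal{L}=\mathbb{Z}\eta_1+\mathbb{Z}\eta_2$ be the lattice in $\mathbb{C}$ generated by $\eta_1,\eta_2$, and let $\mathcal{X}=\{\xi+x\eta_1+y\eta_2 : x\in[0,1),\ y\in[0,1)\}$, a fundamental domain of $\mathcal{L}$. The rotational beta transformation $T:\mathcal{X}\to\mathcal{X}$ is $T(z)=\beta\zeta z-d(z)$, where $d(z)$ is the unique element of $\mathcal{L}$ with $\beta\zeta z\in\mathcal{X}+d(z)$. The expansion of $z\in\mathcal{X}$ is the sequence $d_1d_2\dots$ with $d_n=d(T^{n-1}(z))$. $\partial(\mathcal{X})$ denotes the boundary of $\mathcal{X}$. The two open segments of $\partial(\mathcal{X})$ from $\xi+\eta_1$ to $\xi+\eta_1+\eta_2$ and from $\xi+\eta_2$ to $\xi+\eta_1+\eta_2$ lie outside $\mathcal{X}$; for these segments the images by $T$ are defined by an infinitesimally small perturbation, e.g. for the first one takes the image of the segment connecting $\xi+\eta_1(1-\varepsilon)$ and $\xi+\eta_1(1-\varepsilon)+\eta_2$ for an infinitesimally small $\varepsilon>0$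 (and similarly for the second). For $n<0$, $T^{n}$ of a set denotes its preimage under $T^{-n}$. Symbolic system: let $\mathcal{A}=\{d(z): z\in\mathcal{X}\}$, let $\mathcal{A}^*$ be the set of finite words over $\mathcal{A}$ and $\mathcal{A}^{\mathbb{Z}}$ the set of bi-infinite words. A word $w\in\mathcal{A}^*$ is admissible if it appears (as a block of consecutive letters) in the expansion $d_1d_2\dots$ of some $z\in\mathcal{X}\setminus\bigcup_{n=-\infty}^{\infty}T^n(\partial(\mathcal{X}))$. Let $\mathcal{X}_T=\{(w_j)\in\mathcal{A}^{\mathbb{Z}} : w_jw_{j+1}\cdots w_k \text{ is admissible for all } (j,k)\in\mathbb{Z}^2 \text{ with } j\le k\}$, with the shift $s((w_j))=(w_{j+1})$. The system $(\mathcal{X}_T,s)$, or simply $(\mathcal{X},T)$, is called sofic if there is a finite directed graph $G$ with edges labeled by $\mathcal{A}$ such that for each $w\in\mathcal{X}_T$ there is a bi-infinite path in $G$ labeled $w$, and vice versa (the label sequence of every bi-infinite path in $G$ belongs to $\mathcal{X}_T$). A Pisot number is a real algebraic integer greater than $1$ all of whose other Galois conjugates have absolute value less than $1$. *)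

(* Defs.v *)
From HB Require Import structures.
From mathcomp Require Import all_boot all_order all_algebra.
From mathcomp Require Import all_classical all_reals topology normedtype.
From mathcomp Require Import complex.

Set Implicit Arguments.
Unset Strict Implicit.
Unset Printing Implicit Defensive.

Import Order.TTheory GRing.Theory Num.Theory numFieldNormedType.Exports.

Local Open Scope classical_set_scope.
Local Open Scope ring_scope.
Local Open Scope complex_scope.

(* In characteristic 0 this is the field Q(s); fieldExtType only covers finite
   extensions, whereas here the ambient field is C. *)
Definition generated_field (F : fieldType) (s : seq F) : set F :=
  smallest [set K : set F | divring_closed (mem K)] [set` s].

Definition galois_conjugate (F : fieldType) (x y : F) : Prop :=
  exists p : {poly rat}, [/\ irreducible_poly p,
    root (map_poly ratr p) x & root (map_poly ratr p) y].

Definition pisot (R : realType) (beta : R) : Prop :=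
  [/\ integralOver (intr : int -> R) beta, 1 < beta &
      forall z : R[i], galois_conjugate beta%:C z -> z != beta%:C ->
        `|z| < 1].

Definition boundary (T : topologicalType) (A : set T) : set T :=
  closure A `\` interior A.

(* Bi-infinite label sequences; E is a type of edges, so that multiple edges
   and loops are allowed. *)
Definition sofic (L : Type) (A : set L) (S : set (int -> L)) : Prop :=
  exists (V E : finType) (src tgt : E -> V) (lab : E -> L),
    (forall e, A (lab e)) /\
    forall w : int -> L, S w <->
      exists p : int -> E, (forall j, tgt (p j) = src (p (j + 1))) /\
                           (forall j, lab (p j) = w j).

Section RotationalBeta.

Context {R : realType} (beta : R) (zeta eta1 eta2 xi : R[i]).

Definition rb_lattice : set R[i] :=
  [set d | exists m n : int, d = m%:~R * eta1 + n%:~R * eta2].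

Definition rb_domain : set R[i] :=
  [set z | exists x y : R, [/\ 0 <= x < 1, 0 <= y < 1 &
     z = xi + x%:C * eta1 + y%:C * eta2]].

(* The default value 0 of xget is never used when eta1 / eta2 is not real. *)
Definition rb_digit (z : R[i]) : R[i] :=
  xget 0 [set d | rb_lattice d /\
    exists2 x, rb_domain x & beta%:C * zeta * z = x + d].

Definition rb_map (z : R[i]) : R[i] := beta%:C * zeta * z - rb_digit z.

(* 0-based: rb_expansion z n is the letter d_(n+1). *)
Definition rb_expansion (z : R[i]) (n : nat) : R[i] :=
  rb_digit (iter n rb_map z).

Definition rb_boundary : set R[i] := boundary (rb_domain : set R[i]^o).

Definition rb_side1 : set R[i] :=
  [set z | exists2 y : R, 0 < y < 1 & z = xi + eta1 + y%:C * eta2].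

Definition rb_side2 : set R[i] :=
  [set z | exists2 x : R, 0 < x < 1 & z = xi + x%:C * eta1 + eta2].

(* The image at z of a side outside the domain, the side being moved by an
   infinitesimal amount along - eta into the domain. *)
Definition rb_perturbed_image (eta z w : R[i]) : Prop :=
  (rb_map (z - e%:C * eta) : R[i]^o) @[e --> (0 : R)^'+] --> (w : R[i]^o).

(* Points of A that are neither in the domain nor on one of the two open sides
   (for A inside the closure of the domain: three corners) have no image. *)
Definition rb_image (A : set R[i]) : set R[i] :=
  rb_map @` (A `&` rb_domain)
  `|` [set w | exists2 z, (A `&` rb_side1) z & rb_perturbed_image eta1 z w]
  `|` [set w | exists2 z, (A `&` rb_side2) z & rb_perturbed_image eta2 z w].

Definition rb_power (n : int) (A : set R[i]) : set R[i] :=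
  match n with
  | Posz k => iter k rb_image A
  | Negz k => rb_domain `&` (iter k.+1 rb_map) @^-1` A
  end.

Definition rb_alphabet : set R[i] := rb_digit @` rb_domain.

Definition rb_admissible (w : seq R[i]) : Prop :=
  exists2 z, (rb_domain `\` \bigcup_(n : int) rb_power n rb_boundary) z &
    exists n : nat, w = [seq rb_expansion z (n + i)%N | i <- iota 0 (size w)].

Definition rb_shift_space : set (int -> R[i]) :=
  [set w | (forall j, rb_alphabet (w j)) /\
     forall j k : int, j <= k ->
       rb_admissible [seq w (j + i%:Z) | i <- iota 0 `|k - j|%N.+1]].

Definition rb_sofic : Prop := sofic rb_alphabet rb_shift_space.

End RotationalBeta.

(* Main.v *)
Require Import Defs.
From mathcomp Require Import all_boot all_order all_algebra all_field.
From mathcomp Require Import all_classical all_reals topology normedtype.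
From mathcomp Require Import lebesgue_measure.
From mathcomp Require Import complex ring lra zify.

Set Implicit Arguments.
Unset Strict Implicit.
Unset Printing Implicit Defensive.

Import Order.TTheory GRing.Theory Num.Theory numFieldNormedType.Exports.

Local Open Scope classical_set_scope.
Local Open Scope ring_scope.
Local Open Scope complex_scope.

(** Let [cell u] be the set of the points that are reached, after the digits of
    [u] have been read, by the orbits that stay inside the open domain. It is an
    open convex polygon, and reading one more digit [a] turns a cell [U] into
    the part inside the open domain of its image by [z |-> beta zeta z - a]
    ([cell_step]), so that a cell determines all the later ones. Two facts make
    the nonempty cells the vertices of a finite graph that presents the system.

    A word over the alphabet is admissible if and only if its cell is nonempty.
    An orbit that never meets the boundary stays in the open domain, and its
    points witness that the cells of its blocks are nonempty
    ([admissible_cell]). Conversely, the points whose orbit realizes a given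
    word inside the open domain form an open set, while the points excluded from
    the definition of admissibility, namely all the images and preimages of the
    boundary, lie on countably many lines; hence if the open set is nonempty it
    contains a point that is not excluded ([cell_admissible]).

    There are finitely many cells ([finite_cells]). Each of them is cut out of
    the domain by half-planes [0 < 2 Re (g w) + b], and reading [a] sends the
    pair [(g, b)] to [(g / zeta, beta b + 2 Re ((g / zeta) a))]. As [zeta] is a
    root of unity, [g] takes finitely many values. As [zeta + zeta^-1] is in
    Q(beta), complex conjugation acts on Q(zeta, beta) = Q(beta) + Q(beta) zeta
    and the real numbers [2 Re (g a)] all belong to a finite subset of Q(beta)
    ([generated_field_Re2]). The conjugates of [beta] have modulus less than 1,
    so the conjugates of [b] remain bounded, and so do its denominators; since
    an algebraic number of given degree and denominator is determined up to
    finitely many possibilities by a bound on all its conjugates, only finitely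
    many [b] lie in a given bounded interval ([pisot_finite_orbit]). Outside of
    a large interval [b] does not matter, because the half-plane then contains
    the whole domain or misses it.

    A bi-infinite word of the shift space is the label of a path: for a fixed
    time [j] the cells of the blocks of length [n] that end just before [j]
    decrease with [n] within a finite family, and their eventual value is the
    vertex visited at time [j] ([shift_space_paths]). *)

(** * Pisot numbers *)

Lemma map_intr_rat (L : numFieldType) (p : {poly int}) :
  map_poly (ratr : rat -> L) (map_poly intr p) = map_poly intr p.
Proof. by rewrite -map_poly_comp; apply: eq_map_poly => b; rewrite /= rmorph_int. Qed.

(** Gauss's lemma: the minimal polynomial over the rationals divides a monic
    integer polynomial, so up to a sign it is itself monic with integer
    coefficients. Integrality matters because the remainder modulo a monic
    integer polynomial stays in Z[X]. *)
Lemma integral_irreducible_int (L : numFieldType) (x : L) :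
  integralOver (intr : int -> L) x ->
  exists m : {poly int}, [/\ m \is monic,
    irreducible_poly (map_poly intr m : {poly rat}) & root (map_poly intr m) x].
Proof.
move=> [f mon_f fx0].
have intrI : injective (intr : int -> rat) by exact: intr_inj.
have nzI (p : {poly int}) : p != 0 -> (map_poly intr p : {poly rat}) != 0.
  by move=> p0; rewrite map_poly_eq0_id0 // ?intr_eq0 ?lead_coef_eq0.
pose ann n := `[< exists q : {poly rat},
  [/\ q != 0, root (map_poly ratr q) x & size q = n] >].
have /ex_minnP[n /asboolP[r [r0 rx0 <-]] min_r] : exists n, ann n.
  exists (size (map_poly intr f : {poly rat})); apply/asboolP.
  by exists (map_poly intr f); rewrite map_intr_rat nzI // monic_neq0.
have {}min_r q : root (map_poly ratr q) x -> q != 0 -> (size r <= size q)%N.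
  by move=> qx0 q0; apply: min_r; apply/asboolP; exists q.
have irr_r : irreducible_poly r by apply/(subfx_irreducibleP rx0 r0).
have : r %| map_poly intr f.
  apply: contraT; rewrite -irreducible_poly_coprime //.
  move=> /Bezout_coprimepP[[u v]] /= /eqp_size.
  rewrite size_poly1 => /eqP/size_poly1P[c c0 /(congr1 (map_poly (ratr : rat -> L)))].
  rewrite rmorphD !rmorphM /= map_intr_rat => /(congr1 (fun p => p.[x])).
  rewrite hornerD !hornerM (rootP rx0) (rootP fx0) !mulr0 addr0 map_polyC hornerC.
  by move=> /esym/eqP; rewrite fmorph_eq0 (negPf c0).
move=> /dvdpP_rat_int[p1 [a a0 Dr] [s Df]].
have /(congr1 (fun p => lead_coef p)) := Df.
rewrite lead_coefM (monicP mon_f) => /esym lead_p1s.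
have lu : lead_coef p1 \is a GRing.unit.
  by apply/unitrPr; exists (lead_coef s).
have p10 : p1 != 0 by rewrite -lead_coef_eq0; apply: contraTneq lu => ->.
have l2 : lead_coef p1 * lead_coef p1 = 1.
  by case/orP: lu => /eqP ->.
pose m := lead_coef p1 *: p1.
have mm : m \is monic by rewrite monicE lead_coefZ l2.
have m_nz : (map_poly intr m : {poly rat}) != 0 by rewrite nzI // monic_neq0.
have mE : map_poly intr m = ((lead_coef p1)%:~R / a) *: r :> {poly rat}.
  by rewrite Dr scalerA mulfVK // map_polyZ.
have mx0 : root (map_poly ratr (map_poly intr m : {poly rat})) x.
  by rewrite mE map_polyZ /root hornerZ (rootP rx0) mulr0.
exists m; split=> //; last by rewrite -map_intr_rat.
apply/(subfx_irreducibleP mx0 m_nz) => q qx0 q0.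
rewrite mE size_scale; first exact: min_r.
by apply: contraNneq m_nz => c0; rewrite mE c0 scale0r.
Qed.

(** Irreducible polynomials over the rationals are separable, so over an
    algebraically closed field they have as many distinct roots as their degree. *)
Lemma irreducible_int_split (L : numClosedFieldType) (m : {poly int}) :
  m \is monic -> irreducible_poly (map_poly intr m : {poly rat}) ->
  exists2 rs : seq L, uniq rs & map_poly intr m = \prod_(r <- rs) ('X - r%:P).
Proof.
move=> mon_m irr_m.
have [rs Dm] := closed_field_poly_normal (map_poly intr m : {poly L}).
have mon_mL : (map_poly intr m : {poly L}) \is monic.
  by apply: monic_map.
rewrite (monicP mon_mL) scale1r in Dm.
exists rs => //; rewrite -separable_prod_XsubC -Dm -map_intr_rat separable_map.
have nz := irredp_neq0 irr_m.
rewrite separable_poly.unlock irreducible_poly_coprime //.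
have [irr_size _] := irr_m.
apply: contraL irr_size => /dvdp_leq le_m; rewrite -leqNgt.
rewrite leqNgt; apply/negP => sz.
have /le_m : (map_poly intr m : {poly rat})^`() != 0.
  rewrite -size_poly_eq0 polyorder.size_deriv.
  by case: (size _) sz => [|[|]].
by rewrite leqNgt lt_size_deriv.
Qed.

Lemma finite_bounded_int_poly (n N : nat) :
  finite_set [set P : {poly int} |
    (size P <= n)%N /\ forall i, (`|(P`_i)%R| <= N)%N].
Proof.
pose F (f : {ffun 'I_n -> 'I_(N + N).+1}) : {poly int} :=
  \poly_(i < n) (if insub i is Some j then (f j)%:Z - N%:Z else 0).
apply: (@sub_finite_set _ _ [set F f | f in [set: {ffun 'I_n -> 'I_(N + N).+1}]]).
  move=> P [sP bP]; exists [ffun j : 'I_n => inord `|(P`_j + N%:Z)%R|%N] => //.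
  apply/polyP => i; rewrite coef_poly; case: ltnP => [i_n|n_i]; last first.
    by rewrite nth_default // (leq_trans sP).
  by rewrite insubT ffunE /= inordK; move: (bP i); move: (P`_i) => c; lia.
apply: finite_image.
have -> : [set: {ffun 'I_n -> 'I_(N + N).+1}] = [set` {: {ffun 'I_n -> 'I_(N + N).+1}}].
  by apply/seteqP; split => f // _; rewrite /= inE.
exact: finite_finpred.
Qed.

(** The coefficients of a polynomial of degree less than [size rs] depend
    linearly on its values on [rs], through the inverse of a Vandermonde
    matrix, so bounds on the values bound the coefficients. *)
Lemma finite_int_poly_bounded_values (R : realType) (rs : seq R[i]) (B : R[i]) :
  uniq rs ->
  finite_set [set P : {poly int} | (size P <= size rs)%N /\
     forall r, r \in rs -> `|(map_poly intr P).[r]| <= B].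
Proof.
move=> urs; set n := size rs.
pose a : 'rV[R[i]]_n := \row_j rs`_j.
pose V := Vandermonde n a.
have Vu : V \in unitmx.
  rewrite unitmxE det_Vandermonde unitfE; apply/prodf_neq0 => i _.
  apply/prodf_neq0 => j ij; rewrite !mxE subr_eq0 nth_uniq //.
  by rewrite neq_ltn ij orbT.
pose K := \sum_(i < n) \sum_(j < n) `|B| * `|invmx V j i|.
have K0 : 0 <= K.
  by apply: sumr_ge0 => i _; apply: sumr_ge0 => j _; rewrite mulr_ge0.
have KE : K = (complex.Re K)%:C by rewrite RRe_real // ger0_real.
pose N := Num.bound (complex.Re K).
apply: sub_finite_set (finite_bounded_int_poly n N) => P [sP vP]; split=> // i.
have [i_n|n_i] := ltnP i n; last by rewrite nth_default ?(leq_trans sP).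
pose v : 'rV[R[i]]_n := \row_j (P`_j)%:~R.
pose w := v *m V.
have wE j : w 0 j = (map_poly intr P).[rs`_j].
  rewrite mxE (@horner_coef_wide _ n); last first.
    by apply: leq_trans sP; apply: size_poly.
  by apply: eq_bigr => k _; rewrite !mxE coef_map.
have PE : (P`_i)%:~R = \sum_(j < n) w 0 j * invmx V j (Ordinal i_n).
  have -> : (P`_i)%:~R = v 0 (Ordinal i_n) by rewrite mxE.
  by rewrite -{1}[v](mulmxK Vu) -/w mxE.
have : `|(P`_i)%:~R : R[i]| <= K.
  rewrite PE (le_trans (ler_norm_sum _ _ _)) //.
  rewrite /K [leRHS](bigD1 (Ordinal i_n)) //= -[leLHS]addr0 lerD //; last first.
    by apply: sumr_ge0 => k _; apply: sumr_ge0 => j _; rewrite mulr_ge0.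
  apply: ler_sum => j _; rewrite normrM ler_wpM2r // wE.
  have /vP h : rs`_j \in rs by apply: mem_nth.
  apply: (le_trans h); rewrite real_ler_norm // ger0_real //.
  exact: le_trans h.
rewrite -intr_norm KE.
have -> : (`|P`_i| %:~R : R[i]) = (`|P`_i|%:~R : R)%:C by rewrite rmorph_int.
rewrite lecR => h.
have := le_lt_trans h (archi_boundP _).
rewrite -/N -ler0c -KE => /(_ K0).
rewrite pmulrn ltr_int; move: (P`_i) => c; lia.
Qed.

(** A disk around 0 that is stable under the finitely many maps [y |-> c y + d]
    with [`|c| = rho x < 1] and [`|d| = h x]: its radius has to exceed each
    [h x / (1 - rho x)], and the sum of these will do. *)
Lemma common_horner_bound (F : numFieldType) (T : eqType) (s : seq T)
    (rho h : T -> F) :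
  (forall x, x \in s -> rho x < 1 /\ 0 <= h x) ->
  exists2 C, 0 <= C & forall x, x \in s -> rho x * C + h x <= C.
Proof.
elim: s => [|x s IHs] hs; first by exists 0.
have /IHs[C C0 hC] : forall y, y \in s -> rho y < 1 /\ 0 <= h y.
  by move=> y ys; apply: hs; rewrite inE ys orbT.
have [rx hx] := hs x (mem_head _ _).
have rx0 : 0 < 1 - rho x by rewrite subr_gt0.
have D0 : 0 <= h x / (1 - rho x) by rewrite divr_ge0 // ltW.
exists (C + h x / (1 - rho x)); first exact: addr_ge0.
move=> y; rewrite inE => /predU1P[->|ys].
  rewrite -lerBrDl -[X in X - _]mul1r -mulrBl mulrDr [X in _ + X]mulrC divfK ?gt_eqF //.
  by rewrite lerDr mulr_ge0 // ltW.
have /hs[ry _] : y \in x :: s by rewrite inE ys orbT.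
rewrite mulrDr -addrA [_ + h y]addrC addrA lerD ?hC //.
by rewrite ler_piMl // ltW.
Qed.

Lemma common_denominator (F : numFieldType) (x : F) (s : seq F) :
  (forall a, a \in s -> exists P : {poly rat}, a = (map_poly ratr P).[x]) ->
  exists2 N : int, N != 0 &
    forall a, a \in s -> exists P : {poly int}, N%:~R * a = (map_poly intr P).[x].
Proof.
elim: s => [|a s IHs] hs; first by exists 1.
have /IHs[N N0 hN] : forall b, b \in s ->
    exists P : {poly rat}, b = (map_poly ratr P).[x].
  by move=> b bs; apply: hs; rewrite inE bs orbT.
have [P ->] := hs a (mem_head _ _).
have [Q [d d0 ->]] := rat_poly_scale P.
exists (d * N) => [|b]; first by rewrite mulf_neq0.
rewrite inE => /predU1P[->|/hN[Qb hb]]; last first.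
  by exists (d *: Qb); rewrite map_polyZ hornerZ /= -hb rmorphM mulrA.
exists (N *: Q); rewrite !map_polyZ /= !hornerZ map_intr_rat.
by rewrite fmorphV /= ratr_int rmorphM /= [_ * N%:~R]mulrC -mulrA mulVKf ?intr_eq0.
Qed.

(** The set [W] consists of the numbers [P(beta) / N], with [P] an integer
    polynomial whose values at the other conjugates of [beta] are bounded by a
    fixed [C0]. These conjugates are contracting, so [C0] can be chosen such that
    the affine maps preserve the bounds. In a bounded interval the value at
    [beta] is bounded as well, and the remainder of [P] modulo the minimal
    polynomial then has one of finitely many values. *)
Lemma pisot_finite_orbit (R : realType) (beta : R) (A : set R) :
  pisot beta -> finite_set A ->
  (forall a, A a -> exists P : {poly rat}, a = (map_poly ratr P).[beta]) ->
  exists W : set R, [/\ A `<=` W,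
    forall b a, W b -> A a -> W (beta * b + a) &
    forall C : R, finite_set [set b | W b /\ `|b| <= C]].
Proof.
move=> [beta_int beta_gt1 beta_conj] /finite_seqP[s ->] Apoly.
have [N N0 hN] := common_denominator Apoly.
have {hN} /choice[Q hQ] : forall a : R, exists Q : {poly int},
    a \in s -> N%:~R * a = (map_poly intr Q).[beta].
  move=> a; have [/hN[Q ->]|] := boolP (a \in s); first by exists Q.
  by exists 0.
have [m [mon_m irr_m mb0]] := integral_irreducible_int beta_int.
have [rs urs Dm] := irreducible_int_split R[i] mon_m irr_m.
have evC (P : {poly int}) :
    (map_poly intr P).[beta%:C] = ((map_poly intr P).[beta])%:C :> R[i].
  rewrite -horner_map -map_poly_comp; congr _.[_].
  by apply: eq_map_poly => c; rewrite /= rmorph_int.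
have rootm r : r \in rs -> root (map_poly intr m) r.
  by rewrite Dm root_prod_XsubC.
have conj_lt1 r : r \in rs -> r != beta%:C -> `|r| < 1.
  move=> /rootm mr0; apply: beta_conj; exists (map_poly intr m).
  by split; rewrite // map_intr_rat // /root evC (rootP mb0).
pose ev r (P : {poly int}) : R[i] := (map_poly intr P).[r].
pose rs' := [seq r <- rs | r != beta%:C].
have [C0 C0_ge0 hC0] : exists2 C : R[i], 0 <= C &
    forall x, x \in [seq (r, a) | r <- rs', a <- s] ->
      `|x.1| * C + `|ev x.1 (Q x.2)| <= C.
  apply: common_horner_bound => _ /allpairsP[[r a] /= [rrs as_ ->]] /=.
  by move: rrs; rewrite mem_filter => /andP[rb /conj_lt1 ->].
pose bounded P := forall r, r \in rs' -> `|ev r P| <= C0.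
exists [set b | exists2 P, N%:~R * b = (map_poly intr P).[beta] & bounded P].
split.
- move=> a /= as_; exists (Q a); first exact: hQ.
  move=> r rrs; apply: le_trans (hC0 (r, a) _); last exact: allpairs_f.
  by rewrite lerDr mulr_ge0.
- move=> b a [P NbP hP] /= as_ ; exists ('X * P + Q a).
    rewrite rmorphD rmorphM /= map_polyX hornerD hornerM hornerX -hQ // -NbP.
    by rewrite mulrDr mulrCA.
  move=> r rrs; apply: le_trans (hC0 (r, a) _); last exact: allpairs_f.
  rewrite /ev rmorphD rmorphM /= map_polyX hornerD hornerM hornerX.
  rewrite (le_trans (ler_normD _ _)) // lerD2r normrM ler_wpM2l //.
  exact: hP.
move=> C; pose B := C0 + (`|N%:~R| * C)%:C.
apply: (@sub_finite_set _ _ [set (map_poly intr P).[beta] / N%:~R |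
    P in [set P : {poly int} | (size P <= size rs)%N /\
           forall r, r \in rs -> `|(map_poly intr P).[r]| <= B]]); last first.
  exact/finite_image/finite_int_poly_bounded_values.
move=> b [[P NbP hP] bC].
pose P' := Pdiv.CommonRing.rmodp P m.
have m0 : m != 0 by exact: monic_neq0.
have evP' (F : numFieldType) (r : F) : root (map_poly intr m) r ->
    (map_poly intr P').[r] = (map_poly intr P).[r].
  move=> /rootP mr0; rewrite [in RHS](Pdiv.RingMonic.rdivp_eq mon_m P).
  by rewrite rmorphD rmorphM /= hornerD hornerM mr0 mulr0 add0r.
exists P'; last by rewrite evP' // -NbP mulrC mulKf // intr_eq0.
split.
  have := Pdiv.CommonRing.ltn_rmodpN0 P m0; rewrite -/P'.
  have -> : size m = size (map_poly intr m : {poly R[i]}).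
    by rewrite size_map_inj_poly //; apply: intr_inj.
  by rewrite Dm size_prod_XsubC.
have C_ge0 : 0 <= C by apply: le_trans bC.
move=> r rrs; rewrite evP' ?rootm //.
have [->|rb] := eqVneq r beta%:C.
  rewrite evC -NbP /B -[leLHS]add0r lerD //.
  rewrite rmorphM normrM rmorphM rmorph_int /=.
  have -> : `|N%:~R|%:C = `|N%:~R : R[i]|.
    by rewrite -!intr_norm rmorph_int.
  rewrite ler_wpM2l // normc_def /= expr0n addr0 sqrtr_sqr lecR //.
rewrite -[leLHS]addr0 lerD // ?ler0c ?mulr_ge0 //.
by apply: hP; rewrite mem_filter rb.
Qed.

(** * The field generated by a root of unity and a Pisot number *)

Lemma integral_field_closed (L : numFieldType) (x : L) :
  integralOver (intr : int -> L) x ->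
  divring_closed (mem [set y : L | exists P : {poly rat}, y = (map_poly ratr P).[x]]).
Proof.
move=> /integral_irreducible_int[m [_ irr_m mx0]]; split.
- by rewrite in_setE; exists 1; rewrite rmorph1 hornerC.
- move=> _ _ /[!in_setE] -[P ->] [Q ->]; exists (P - Q).
  by rewrite rmorphB hornerD hornerN.
move=> _ _ /[!in_setE] -[P ->] [Q ->].
have [Qx0|Qx0] := eqVneq (map_poly ratr Q).[x] 0.
  by exists 0; rewrite Qx0 invr0 mulr0 rmorph0 horner0.
have : coprimep (map_poly intr m) Q.
  rewrite irreducible_poly_coprime //; apply: contra Qx0 => /dvdpP[D ->].
  by rewrite rmorphM /= hornerM map_intr_rat (rootP mx0) mulr0.
move=> /Bezout_coprimepP[[u v]] /= /eqp_size.
rewrite size_poly1 => /eqP/size_poly1P[c c0 /(congr1 (map_poly (ratr : rat -> L)))].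
rewrite rmorphD !rmorphM /= map_intr_rat => /(congr1 (fun p => p.[x])).
rewrite hornerD !hornerM (rootP mx0) mulr0 add0r map_polyC hornerC /= => vQ.
have v0 : (map_poly ratr v).[x] != 0.
  apply: contra_neq c0 => v0; apply/eqP.
  by rewrite -(fmorph_eq0 (ratr : {rmorphism rat -> L})) /= -vQ v0 mul0r.
exists (c^-1 *: (P * v)); rewrite map_polyZ hornerZ rmorphM hornerM /= fmorphV /= -vQ.
by field; apply/andP.
Qed.

Lemma divring_closed_setP (F : fieldType) (K : set F) :
  divring_closed (mem K) ->
  [/\ K 0, K 1, (forall x y, K x -> K y -> K (x + y)) &
      (forall x y, K x -> K y -> K (x - y))] /\
  [/\ forall x y, K x -> K y -> K (x * y),
      forall x, K x -> K x^-1 & forall x y, K x -> K y -> K (x / y)].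
Proof.
move=> [K1 KB KV]; rewrite !in_setE in K1.
have {}KB x y : K x -> K y -> K (x - y).
  by move=> Kx Ky; rewrite -in_setE; apply: KB; rewrite in_setE.
have {}KV x y : K x -> K y -> K (x / y).
  by move=> Kx Ky; rewrite -in_setE; apply: KV; rewrite in_setE.
have K0 : K 0 by rewrite -(subrr 1); apply: KB.
have Ki x : K x -> K x^-1 by move=> Kx; rewrite -[_^-1]mul1r; apply: KV.
split; split=> // x y Kx Ky.
- by rewrite -[y]opprK -[- y]sub0r; apply/KB/KB.
- by rewrite -[y]invrK; apply/KV/Ki.
Qed.

Lemma generated_field_closed (F : fieldType) (s : seq F) :
  divring_closed (mem (generated_field s)).
Proof.
split; first by rewrite in_setE => K [[+ _ _] _]; rewrite in_setE.
  move=> x y /[!in_setE] hx hy K hK; have [[_ KB _] _] := hK.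
  by have := KB x y; rewrite !in_setE; apply; [apply: hx|apply: hy].
move=> x y /[!in_setE] hx hy K hK; have [[_ _ KV] _] := hK.
by have := KV x y; rewrite !in_setE; apply; [apply: hx|apply: hy].
Qed.

Lemma generated_field_gen (F : fieldType) (s : seq F) x :
  x \in s -> generated_field s x.
Proof. by move=> xs K [_]; apply. Qed.

Lemma generated_field_sub (F : fieldType) (s : seq F) (K : set F) :
  divring_closed (mem K) -> (forall x, x \in s -> K x) ->
  generated_field s `<=` K.
Proof. by move=> Kc sK x; apply; split. Qed.

Lemma unity_root_conj (R : realType) (q : nat) (zeta : R[i]) :
  (0 < q)%N -> q.-unity_root zeta -> zeta * zeta^* = 1.
Proof.
move=> q0 /unity_rootP zq; rewrite -sqr_normc.
have : `|zeta| ^+ q == 1 by rewrite -normrX zq normr1.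
by rewrite pexpr_eq1 // => /eqP ->; rewrite expr1n.
Qed.

Section CyclotomicField.
Variables (R : realType) (q : nat) (zeta : R[i]) (beta : R).
Hypotheses (q_gt0 : (0 < q)%N) (zeta_root : q.-unity_root zeta).

Let K := generated_field [:: zeta; beta%:C].

(** Conjugation fixes [beta] and inverts [zeta], so the elements with a conjugate
    in [K] form a field that contains the generators. *)
Lemma generated_field_conj z : K z -> K z^*.
Proof.
have zz1 := unity_root_conj q_gt0 zeta_root.
have z0 : zeta != 0.
  by apply: contra_eq_neq zz1 => ->; rewrite mul0r eq_sym oner_neq0.
have [[K0 K1 KD KB] [KM KV Kd]] :=
  divring_closed_setP (generated_field_closed [:: zeta; beta%:C]).
suff sub : K `<=` [set z | K z^*] by exact: sub.
apply: generated_field_sub; last first.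
  move=> x; rewrite !inE => /orP[]/eqP ->.
    rewrite /= -[zeta^*](mulKf z0) zz1 mulr1.
    by apply: KV; apply: generated_field_gen; rewrite mem_head.
  change (K (beta%:C)^*); rewrite conjc_real.
  by apply: generated_field_gen; rewrite !inE eqxx orbT.
split; first by rewrite in_setE; change (K 1^*); rewrite conjc1.
  move=> x y; rewrite !in_setE => Kx Ky; change (K (x - y)^*).
  by rewrite rmorphB; apply: KB.
move=> x y; rewrite !in_setE => Kx Ky; change (K (x / y)^*).
by rewrite rmorphM /= conjc_inv; apply: Kd.
Qed.

Hypothesis beta_int : integralOver (intr : int -> R) beta.
Hypothesis zeta_trace : generated_field [:: beta%:C] (zeta + zeta^-1).

(** The hypothesis on the trace makes Q(beta) + Q(beta) zeta a field: the
    inverse of [y] is its conjugate divided by a norm, and both the norm and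
    the conjugate are expressed with [zeta + zeta^-1]. Twice the real part is
    the trace down to Q(beta). *)
Lemma generated_field_Re2 z : K z ->
  exists P : {poly rat}, 2 * complex.Re z = (map_poly ratr P).[beta].
Proof.
have zz1 := unity_root_conj q_gt0 zeta_root.
have z0 : zeta != 0.
  by apply: contra_eq_neq zz1 => ->; rewrite mul0r eq_sym oner_neq0.
have zV : zeta^* = zeta^-1 by apply: (mulfI z0); rewrite zz1 divff.
pose Q := [set y : R | exists P : {poly rat}, y = (map_poly ratr P).[beta]].
have [[Q0 Q1 QD QB] [QM QV Qd]] := divring_closed_setP (integral_field_closed beta_int).
have [t Qt tE] : exists2 t, Q t & zeta + zeta^-1 = t%:C.
  move: zeta_trace.
  apply: (@generated_field_sub _ _ [set z : R[i] | exists2 t, Q t & z = t%:C]).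
    split; first by rewrite in_setE /=; exists 1.
      move=> _ _ /[!in_setE] -[a Qa ->] [b Qb ->].
      by exists (a - b); [exact: QB|rewrite rmorphB].
    move=> _ _ /[!in_setE] -[a Qa ->] [b Qb ->].
    by exists (a / b); [exact: Qd|rewrite rmorphM fmorphV].
  move=> _ /[!inE] /eqP ->; exists beta => //.
  by exists 'X; rewrite map_polyX hornerX.
pose K2 := [set z : R[i] | exists a b, [/\ Q a, Q b & z = a%:C + b%:C * zeta]].
have zs : zeta^* = t%:C - zeta by rewrite zV -tE addrC addKr.
have zsz : zeta * (t%:C - zeta) = 1 by rewrite -zs.
have K2K : K `<=` K2.
  apply: generated_field_sub; last first.
    move=> x /[!inE] /orP[]/eqP ->; [exists 0, 1|exists beta, 0].
      by rewrite rmorph0 rmorph1 mul1r add0r.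
    rewrite rmorph0 mul0r addr0; split=> //.
    by exists 'X; rewrite map_polyX hornerX.
  split.
  - by rewrite in_setE; exists 1, 0; rewrite rmorph0 rmorph1 mul0r addr0.
  - move=> _ _ /[!in_setE] -[a [b [Qa Qb ->]]] [c [d [Qc Qd' ->]]].
    exists (a - c), (b - d); split; [exact: QB|exact: QB|].
    by rewrite !rmorphB /=; ring.
  move=> _ _ /[!in_setE] -[a [b [Qa Qb ->]]] [c [d [Qc Qd' ->]]].
  set y := c%:C + _.
  have [->|y0] := eqVneq y 0.
    by rewrite invr0 mulr0; exists 0, 0; rewrite rmorph0 mul0r addr0.
  pose n := c * c + c * d * t + d * d.
  have Qn : Q n by apply: (QD); [apply: (QD)|]; do ?apply: (QM).
  have yn : y * (c%:C + d%:C * (t%:C - zeta)) = n%:C.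
    rewrite /y /n !rmorphD !rmorphM /=.
    by rewrite -[d%:C * d%:C]mulr1 -zsz; ring.
  have n0 : n%:C != 0 :> R[i].
    rewrite -yn mulf_neq0 //; rewrite -zs.
    have -> : c%:C + d%:C * zeta^* = y^*.
      by rewrite /y rmorphD rmorphM /= !oppr0.
    by rewrite conjc_eq0.
  exists ((a * c + a * d * t + b * d) / n), ((b * c - a * d) / n); split.
  - by apply: (Qd) => //; apply: (QD); [apply: (QD)|]; do ?apply: (QM).
  - by apply: (Qd) => //; apply: (QB); apply: (QM).
  have -> : y^-1 = (c%:C + d%:C * (t%:C - zeta)) / n%:C.
    by apply: (mulfI y0); rewrite divff // mulrA yn divff.
  rewrite !(rmorphM, fmorphV, rmorphD, rmorphB) mulrA; set nC := (X in X^-1).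
  rewrite [_ / nC * zeta]mulrAC -mulrDl.
  congr (_ / _).
  by rewrite -[b%:C * d%:C]mulr1 -zsz; ring.
move=> /K2K[a [b [Qa Qb ->]]].
have [||P eP] := QD (2 * a) (b * t).
- by rewrite mulrDl mul1r; apply: QD.
- exact: QM.
exists P; rewrite -eP; apply: complexI.
rewrite rmorphM /= -[2]/(1 + 1) rmorphD rmorph1 -[1 + 1]/2 -addcJ.
have -> : (a%:C + b%:C * zeta)^* = a%:C + b%:C * (t%:C - zeta).
  rewrite rmorphD rmorphM; congr (_ + _ * _); [exact: conjc_real|exact: conjc_real|].
  exact: zs.
rewrite !(rmorphM, rmorphD). by ring.
Qed.

End CyclotomicField.

(** * Real linear forms on the complex plane *)

(** Every real linear form is of this kind. The factor 2 makes the value the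
    trace [g z + conj (g z)], so that it stays in Q(beta) when [g] and [z] are in
    Q(zeta, beta). *)
Definition re_form (R : realType) (g z : R[i]) : R := 2 * complex.Re (g * z).

Section ReForm.
Variable R : realType.
Implicit Types (g c z w : R[i]) (r : R).

Lemma re_formE g z : (re_form g z)%:C = g * z + conjc (g * z).
Proof.
case: g z => [a b] [c d]; apply/eqP; rewrite eq_complex /re_form /=.
by apply/andP; split; apply/eqP; ring.
Qed.

Lemma re_formD g z w : re_form g (z + w) = re_form g z + re_form g w.
Proof. by case: g z w => [a b] [c d] [e f]; rewrite /re_form /=; ring. Qed.

Lemma re_formN g z : re_form g (- z) = - re_form g z.
Proof. by case: g z => [a b] [c d]; rewrite /re_form /=; ring. Qed.

Lemma re_formB g z w : re_form g (z - w) = re_form g z - re_form g w.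
Proof. by rewrite re_formD re_formN. Qed.

Lemma re_formNl g z : re_form (- g) z = - re_form g z.
Proof. by case: g z => [a b] [c d]; rewrite /re_form /=; ring. Qed.

Lemma re_formZ g r z : re_form g (r%:C * z) = r * re_form g z.
Proof. by case: g z => [a b] [c d]; rewrite /re_form /=; ring. Qed.

Lemma re_formM g c z : re_form g (c * z) = re_form (g * c) z.
Proof. by rewrite /re_form mulrA. Qed.

Lemma re_form_le g z : `|re_form g z|%:C <= 2 * `|g| * `|z|.
Proof.
rewrite -mulrA -normrM; have := normc_ge_Re (g * z).
rewrite /re_form [`|2 * complex.Re _|]normrM [`|2|]ger0_norm // => h.
have -> : (2 * `|complex.Re (g * z)|)%:C = 2 * `|complex.Re (g * z)|%:C.
  by rewrite [LHS]rmorphM rmorph_nat.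
by rewrite ler_wpM2l.
Qed.

(** Cramer's rule gives the coefficients of the dual basis as [e2^* / D] and
    [- e1^* / D], with [D = e1 e2^* - e1^* e2] nonzero by independence; they
    belong to any field stable under conjugation that contains the basis. *)
Lemma dual_basis (K : set R[i]) (e1 e2 : R[i]) :
  divring_closed (mem K) -> (forall z, K z -> K (conjc z)) -> K e1 -> K e2 ->
  e1 / e2 \isn't Num.real ->
  exists g1 g2, [/\ K g1, K g2,
    forall x y : R, re_form g1 (x%:C * e1 + y%:C * e2) = x,
    forall x y : R, re_form g2 (x%:C * e1 + y%:C * e2) = y &
    forall z, z = (re_form g1 z)%:C * e1 + (re_form g2 z)%:C * e2].
Proof.
move=> /divring_closed_setP[[K0 K1 KD KB] [KM KV Kd]] KJ Ke1 Ke2 nreal.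
have JM (x y : R[i]) : conjc (x * y) = conjc x * conjc y by exact: rmorphM.
have JB (x y : R[i]) : conjc (x - y) = conjc x - conjc y by exact: rmorphB.
have JN (x : R[i]) : conjc (- x) = - conjc x by exact: rmorphN.
have JV (x : R[i]) : conjc (x^-1) = (conjc x)^-1 by exact: conjc_inv.
set c1 := conjc e1; set c2 := conjc e2.
have J1 : conjc c1 = e1 by rewrite conjcK.
have J2 : conjc c2 = e2 by rewrite conjcK.
pose D := e1 * c2 - c1 * e2.
have D0 : D != 0.
  apply: contraNneq nreal => /eqP; rewrite subr_eq0 => /eqP D0.
  have [->|e20] := eqVneq e2 0; first by rewrite invr0 mulr0 rpred0.
  have c20 : c2 != 0 by rewrite conjc_eq0.
  have : conjc (e1 / e2) = e1 / e2.
    rewrite JM JV -/c1 -/c2.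
    by apply: (mulIf e20); apply: (mulIf c20); rewrite divfK // mulrAC divfK // -D0.
  case: (e1 / e2) => a b /= [] h; rewrite complex_real; apply/eqP; lra.
have JD : conjc D = - D by rewrite /D JB !JM -/c1 -/c2 J1 J2; ring.
have KD' : K D by apply: (KB); apply: (KM) => //; apply: KJ.
have g1E z : (re_form (c2 / D) z)%:C = (c2 * z - e2 * conjc z) / D.
  rewrite re_formE !JM JV JD J2.
  by field; rewrite ?oppr_eq0 ?D0.
have g2E z : (re_form (- c1 / D) z)%:C = (e1 * conjc z - c1 * z) / D.
  rewrite re_formE !JM JN JV JD J1.
  by field; rewrite ?oppr_eq0 ?D0.
have Jxy (x y : R) : conjc (x%:C * e1 + y%:C * e2) = x%:C * c1 + y%:C * c2.
  by rewrite rmorphD !rmorphM; congr (_ * _ + _ * _); apply: conjc_real.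
exists (c2 / D), (- c1 / D); split.
- by apply: Kd => //; apply: KJ.
- by rewrite -sub0r; apply: Kd => //; apply: (KB) => //; apply: KJ.
- move=> x y; apply: complexI; rewrite g1E Jxy.
  by apply: (mulIf D0); rewrite divfK // /D; ring.
- move=> x y; apply: complexI; rewrite g2E Jxy.
  by apply: (mulIf D0); rewrite divfK // /D; ring.
move=> z; rewrite g1E g2E; apply: (mulIf D0).
transitivity ((c2 * z - e2 * conjc z) * e1 + (e1 * conjc z - c1 * z) * e2).
  by rewrite /D; ring.
by field.
Qed.

End ReForm.

(** * Cells of words *)

Section Cells.
Variables (R : realType) (beta : R) (zeta : R[i]) (X : set R[i]).
Hypotheses (beta_gt0 : 0 < beta) (zeta_neq0 : zeta != 0).

Definition cell_step (U : set R[i]) (a : R[i]) : set R[i] :=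
  [set w | X w /\ exists2 z, U z & w = beta%:C * zeta * z - a].

Definition cell (u : seq R[i]) : set R[i] := foldl cell_step X u.

Lemma cell_rcons u a : cell (rcons u a) = cell_step (cell u) a.
Proof. by rewrite /cell -cats1 foldl_cat. Qed.

Lemma cell_step_mono U V a : U `<=` V -> cell_step U a `<=` cell_step V a.
Proof. by move=> UV w [Xw [z Uz wE]]; split=> //; exists z => //; apply: UV. Qed.

Lemma foldl_cell_mono U V u :
  U `<=` V -> foldl cell_step U u `<=` foldl cell_step V u.
Proof. by elim: u U V => //= a u IHu U V UV; apply: IHu; apply: cell_step_mono. Qed.

Lemma cell_cons_sub a u : cell (a :: u) `<=` cell u.
Proof.
have sub : cell_step X a `<=` X by move=> w [].
exact: foldl_cell_mono sub.
Qed.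

Definition half_plane (h : R[i] * R) : set R[i] :=
  [set z | 0 < re_form h.1 z + h.2].

Variables (A G : set R[i]) (W : set R) (I : set (R[i] * R)).
Hypothesis G_finite : finite_set G.
Hypothesis G_turn : forall g, G g -> G (g / zeta).
Hypothesis W_expand : forall b g a, W b -> G g -> A a ->
  W (beta * b + re_form g a).
Hypothesis W_finite : forall C : R, finite_set [set b | W b /\ `|b| <= C].
Hypothesis I_sub : I `<=` G `*` W.
Hypothesis X_half_planes : X = [set z | forall h, I h -> half_plane h z].
Hypothesis X_bounded : forall g, exists C : R, forall z, X z -> `|re_form g z| <= C.

(** The number of half-planes grows with the word, so that [S] is arbitrary here;
    only the traces of the half-planes on [X] are finitely many. *)
Definition half_plane_cell (U : set R[i]) : Prop :=
  exists2 S, S `<=` G `*` W & U = [set z | X z /\ forall h, S h -> half_plane h z].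

(** Reading the digit [a] acts on half-planes by turning the direction and
    expanding the constant term. *)
Lemma half_plane_step (h : R[i] * R) a z :
  half_plane (h.1 / zeta, beta * h.2 + re_form (h.1 / zeta) a)
    (beta%:C * zeta * z - a) <-> half_plane h z.
Proof.
rewrite /half_plane /= re_formB -mulrA re_formZ re_formM divfK //.
rewrite [X in 0 < X](_ : _ = beta * (re_form h.1 z + h.2)); last by ring.
by rewrite pmulr_rgt0.
Qed.

Lemma half_plane_cell_step U a :
  A a -> half_plane_cell U -> half_plane_cell (cell_step U a).
Proof.
move=> Aa [S S_sub ->].
pose next (h : R[i] * R) := (h.1 / zeta, beta * h.2 + re_form (h.1 / zeta) a).
exists (next @` (I `|` S)).
  move=> _ [h hIS <-]; have [Gh Wh] : (G `*` W) h by case: hIS => [/I_sub|/S_sub].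
  by split=> /=; [exact: G_turn|apply: W_expand => //; exact: G_turn].
apply/seteqP; split => w /=.
  move=> [Xw [z [Xz Sz] wE]]; split=> // _ [h hIS <-].
  rewrite wE; apply/half_plane_step.
  by case: hIS => [Ih|/Sz //]; move: Xz; rewrite X_half_planes; apply.
move=> [Xw hw]; split=> //.
have bz0 : beta%:C * zeta != 0.
  by rewrite mulf_neq0 // fmorph_eq0 gt_eqF.
pose z := (w + a) / (beta%:C * zeta).
have wE : w = beta%:C * zeta * z - a by rewrite mulrC divfK // addrK.
have hz h : (I `|` S) h -> half_plane h z.
  by move=> hIS; apply/(half_plane_step h a); rewrite -wE; apply: hw; exists h.
exists z => //; split=> [|h Sh]; last by apply: hz; right.
by rewrite X_half_planes => h Ih; apply: hz; left.
Qed.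

(** When the constant term exceeds the bound of the linear form on [X], the
    trace of the half-plane is [X] or empty; the other constant terms are
    finitely many. *)
Lemma finite_half_plane_traces :
  finite_set [set X `&` half_plane h | h in G `*` W].
Proof.
have /choice[C hC] := X_bounded.
pose F g := [set X; set0] `|`
  [set X `&` half_plane (g, b) | b in [set b | W b /\ `|b| <= C g]].
apply: (@sub_finite_set _ _ (\bigcup_(g in G) F g)); last first.
  apply: bigcup_finite => // g _; rewrite finite_setU; split.
    by rewrite finite_setU; split; apply: finite_set1.
  exact: finite_image.
move=> _ [[g b] /= [Gg Wb] <-]; exists g => //.
have [bC|Cb] := leP `|b| (C g); first by right; exists b.
left; have [b0|b0] := leP 0 b.
  left; apply/seteqP; split => z; first by case.
  move=> Xz; split=> //; rewrite /half_plane /=; have := hC g z Xz.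
  by rewrite ger0_norm // in Cb; rewrite ler_norml => /andP[]; lra.
right; apply/seteqP; split => z //= [Xz]; rewrite /half_plane /=.
have := hC g z Xz; rewrite ltr0_norm // in Cb.
by rewrite ler_norml => /andP[]; lra.
Qed.

(** Such a cell only depends on the set of the traces on [X] of its half-planes,
    which is a subset of a finite set. *)
Lemma finite_half_plane_cells : finite_set [set U | half_plane_cell U].
Proof.
have /finite_seqP[s Ds] := finite_half_plane_traces.
pose F (J : {set 'I_(size s)}) := [set z | X z /\
  forall i : 'I_(size s), i \in J -> nth set0 s i z].
apply: (@sub_finite_set _ _ (F @` [set` {: {set 'I_(size s)}}])); last first.
  exact/finite_image/finite_finpred.
move=> U [S S_sub ->].
exists [set i : 'I_(size s) |
  `[< exists2 h, S h & nth set0 s i = X `&` half_plane h >]]%SET => //.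
apply/seteqP; split => z /= [Xz hz]; split=> //.
  move=> h Sh.
  have : [set X `&` half_plane h | h in G `*` W] (X `&` half_plane h).
    by exists h => //; apply: S_sub.
  rewrite Ds /= => ts.
  have is_ : (index (X `&` half_plane h) s < size s)%N by rewrite index_mem.
  have := hz (Ordinal is_); rewrite inE /= nth_index // => /(_ _)[|//].
  by apply/asboolP; exists h.
by move=> i; rewrite inE => /asboolP[h /hz Sh ->].
Qed.

Lemma finite_cells :
  finite_set [set cell u | u in [set u : seq R[i] | forall a, a \in u -> A a]].
Proof.
apply: sub_finite_set finite_half_plane_cells => _ [u Au <-] /=.
elim/last_ind: u Au => [|u a IHu] Au.
  by exists set0 => //; apply/seteqP; split => z //= [].
rewrite cell_rcons; apply: half_plane_cell_step.
  by apply: Au; rewrite mem_rcons mem_head.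
by apply: IHu => b bu; apply: Au; rewrite mem_rcons inE bu orbT.
Qed.

End Cells.

(** * Digits and the open domain *)

Section Domain.
Variables (R : realType) (beta : R) (zeta eta1 eta2 xi g1 g2 : R[i]).
Hypothesis dual1 : forall x y : R, re_form g1 (x%:C * eta1 + y%:C * eta2) = x.
Hypothesis dual2 : forall x y : R, re_form g2 (x%:C * eta1 + y%:C * eta2) = y.
Hypothesis dualK : forall z,
  z = (re_form g1 z)%:C * eta1 + (re_form g2 z)%:C * eta2.

Local Notation lat := (rb_lattice eta1 eta2).
Local Notation dom := (rb_domain eta1 eta2 xi).
Local Notation digit := (rb_digit beta zeta eta1 eta2 xi).
Local Notation T := (rb_map beta zeta eta1 eta2 xi).

Lemma domainP z : dom z <->
  0 <= re_form g1 (z - xi) < 1 /\ 0 <= re_form g2 (z - xi) < 1.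
Proof.
split=> [[x [y [x01 y01 ->]]]|[x01 y01]].
  by rewrite -[xi + _ + _]addrA [xi + _]addrC addrK dual1 dual2.
exists (re_form g1 (z - xi)), (re_form g2 (z - xi)); split=> //.
by rewrite -addrA -dualK addrC subrK.
Qed.

Lemma lattice_form d : lat d ->
  exists m n : int, re_form g1 d = m%:~R /\ re_form g2 d = n%:~R.
Proof.
move=> [m [n ->]]; exists m, n.
have intC (k : int) : k%:~R = (k%:~R : R)%:C by rewrite rmorph_int.
by rewrite !intC dual1 dual2.
Qed.

Lemma latticeP d (m n : int) :
  re_form g1 d = m%:~R -> re_form g2 d = n%:~R -> lat d.
Proof. by move=> dm dn; exists m, n; rewrite {1}[d]dualK dm dn !rmorph_int. Qed.

Lemma lattice_domain_unique z d d' :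
  lat d -> lat d' -> dom (z - d) -> dom (z - d') -> d = d'.
Proof.
have int_eq (m n : int) (x : R) :
    0 <= x - m%:~R < 1 -> 0 <= x - n%:~R < 1 -> m = n.
  move=> /andP[m0 m1] /andP[n0 n1].
  transitivity (Num.floor x); [symmetry|]; apply: floor_def; rewrite intrD.
    by apply/andP; split; lra.
  by apply/andP; split; lra.
move=> /lattice_form[m [n [dm dn]]] /lattice_form[m' [n' [dm' dn']]].
move=> /domainP[h1 h2] /domainP[h1' h2'].
rewrite [d]dualK [d']dualK dm dn dm' dn'.
have sw (a : R[i]) : z - a - xi = z - xi - a by rewrite addrAC.
rewrite !(sw d, sw d') !(re_formB _ (z - xi)) ?dm ?dn ?dm' ?dn' in h1 h2 h1' h2'.
by rewrite (int_eq _ _ _ h1 h1') (int_eq _ _ _ h2 h2').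
Qed.

Lemma domain_digit_exists z : exists2 d, lat d & dom (z - d).
Proof.
pose m := Num.floor (re_form g1 (z - xi)).
pose n := Num.floor (re_form g2 (z - xi)).
pose d := (m%:~R : R)%:C * eta1 + (n%:~R : R)%:C * eta2.
exists d; first by apply: (@latticeP _ m n); rewrite ?dual1 ?dual2.
apply/domainP; rewrite addrAC !(re_formB _ (z - xi)) dual1 dual2.
have := floor_itv (re_form g1 (z - xi)); have := floor_itv (re_form g2 (z - xi)).
rewrite -/m -/n !intrD => /andP[? ?] /andP[? ?]; split; apply/andP; split; lra.
Qed.

Lemma digitP z : lat (digit z) /\ dom (T z).
Proof.
rewrite /rb_map /rb_digit; set S := [set d | _].
suff [] : S (xget 0 S).
  by move=> lS [x dx E]; split=> //; rewrite E addrK.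
have [d ld dd] := domain_digit_exists (beta%:C * zeta * z).
apply: (@xgetPex _ _ S); exists d; split=> //.
by exists (beta%:C * zeta * z - d); rewrite ?subrK.
Qed.

Lemma digit_unique z d : lat d -> dom (beta%:C * zeta * z - d) -> digit z = d.
Proof.
have [lz dz] := digitP z => ld dd.
exact: lattice_domain_unique lz ld dz dd.
Qed.

Lemma domain_bounded : exists C : R, forall z, dom z -> `|z| <= C%:C.
Proof.
exists (complex.Re (`|xi| + `|eta1| + `|eta2|)).
move=> z [x [y [/andP[x0 x1] /andP[y0 y1] ->]]].
have -> : (complex.Re (`|xi| + `|eta1| + `|eta2|))%:C = `|xi| + `|eta1| + `|eta2|.
  by rewrite RRe_real // ger0_real // !addr_ge0.
have h (r : R) (e : R[i]) : 0 <= r -> r < 1 -> `|r%:C * e| <= `|e|.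
  move=> r0 r1; rewrite normrM ger0_norm ?ler0c // ler_piMl //.
  by have := ltW r1; rewrite -lecR.
rewrite (le_trans (ler_normD _ _)) // lerD ?h //.
by rewrite (le_trans (ler_normD _ _)) // lerD ?h.
Qed.

Lemma form_bounded g : exists C : R, forall z, dom z -> `|re_form g z| <= C.
Proof.
have [C hC] := domain_bounded.
exists (complex.Re (2 * `|g|) * C) => z /hC {}hC.
have gE : (complex.Re (2 * `|g|))%:C = 2 * `|g|.
  by rewrite RRe_real // ger0_real // mulr_ge0.
rewrite -lecR (le_trans (re_form_le _ _)) //.
have -> : (complex.Re (2 * `|g|) * C)%:C = 2 * `|g| * C%:C.
  by rewrite [LHS]rmorphM -gE.
by rewrite ler_wpM2l // mulr_ge0.
Qed.

(** A digit is a lattice point, whose two integer coordinates are bounded because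
    [z] and [T z] are. *)
Lemma alphabet_finite : finite_set (rb_alphabet beta zeta eta1 eta2 xi).
Proof.
have [C1 hC1] := form_bounded g1; have [C2 hC2] := form_bounded g2.
have [D1 hD1] := form_bounded (g1 * (beta%:C * zeta)).
have [D2 hD2] := form_bounded (g2 * (beta%:C * zeta)).
pose N := (Num.bound (`|C1 + D1| + `|C2 + D2|)).
pose F (p : 'I_(N + N).+1 * 'I_(N + N).+1) : R[i] :=
  (p.1%:Z - N%:Z)%:~R * eta1 + (p.2%:Z - N%:Z)%:~R * eta2.
apply: (@sub_finite_set _ _ (F @` [set: 'I_(N + N).+1 * 'I_(N + N).+1])); last first.
  apply: finite_image.
  rewrite (_ : setT = [set` {: 'I_(N + N).+1 * 'I_(N + N).+1}]).
    exact: finite_finpred.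
  by apply/seteqP; split => f // _; rewrite /= inE.
move=> _ [z dz <-].
have [/[dup] lz /lattice_form[m [n [dm dn]]] dT] := digitP z.
have E g : re_form g (digit z) = re_form (g * (beta%:C * zeta)) z - re_form g (T z).
  by rewrite -re_formM -re_formB /rb_map opprB addrC subrK.
have bnd (k : int) : `|k%:~R : R| <= `|C1 + D1| + `|C2 + D2| -> (`|k| <= N)%N.
  move=> hk; have := le_lt_trans hk (archi_boundP (le_trans (normr_ge0 _) hk)).
  by rewrite -/N -intr_norm pmulrn ltr_int; lia.
have mN : (`|m| <= N)%N.
  apply: bnd; rewrite -dm E (le_trans (ler_normB _ _)) //.
  have := hD1 _ dz; have := hC1 _ dT; have := ler_norm (C1 + D1).
  have := normr_ge0 (C2 + D2); lra.
have nN : (`|n| <= N)%N.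
  apply: bnd; rewrite -dn E (le_trans (ler_normB _ _)) //.
  have := hD2 _ dz; have := hC2 _ dT; have := ler_norm (C2 + D2).
  have := normr_ge0 (C1 + D1); lra.
exists (inord `|(m + N%:Z)%R|%N, inord `|(n + N%:Z)%R|%N) => //.
rewrite /F /= !inordK; [|lia..].
rewrite [RHS]dualK dm dn !rmorph_int.
by congr (_ %:~R * _ + _ %:~R * _); lia.
Qed.

Definition open_domain : set R[i] :=
  [set z | 0 < re_form g1 (z - xi) < 1 /\ 0 < re_form g2 (z - xi) < 1].

Lemma open_domain_sub : open_domain `<=` dom.
Proof.
by move=> z [/andP[h1 ?] /andP[h2 ?]]; apply/domainP; split; rewrite ltW.
Qed.

Lemma open_domain_center : open_domain (xi + (2^-1)%:C * eta1 + (2^-1)%:C * eta2).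
Proof.
rewrite /open_domain /=; have -> : xi + (2^-1)%:C * eta1 + (2^-1)%:C * eta2 - xi =
  (2^-1)%:C * eta1 + (2^-1)%:C * eta2 by ring.
by rewrite dual1 dual2; split; lra.
Qed.

End Domain.

(** * Thin sets *)

Section Thin.
Variable R : realType.
Implicit Types (A B : set R[i]) (a b c d z : R[i]).

Definition parabola a b c (t : R) : R[i] := a + t%:C * b + (t ^+ 2)%:C * c.

(** Unions of countably many lines are thin, as a line meets a parabola in at
    most two points. Since the condition bears on all the parabolas, it is
    preserved by similarities, and it is preserved by countable unions. *)
Definition thin A : Prop := forall a b c, c / b \isn't Num.real ->
  countable [set t | A (parabola a b c t)].

Lemma thin_sub A B : A `<=` B -> thin B -> thin A.
Proof.
move=> AB tB a b c bc; apply: sub_countable (tB a b c bc).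
by apply: subset_card_le => t /AB.
Qed.

Lemma thin_bigcup (I : countType) (A_ : I -> set R[i]) :
  (forall i, thin (A_ i)) -> thin (\bigcup_i A_ i).
Proof.
move=> tA a b c bc.
have -> : [set t | (\bigcup_i A_ i) (parabola a b c t)] =
    \bigcup_i [set t | A_ i (parabola a b c t)] by [].
by apply: bigcup_countable => // i _; exact: tA.
Qed.

Lemma thin_affine k d A : k != 0 -> thin A -> thin [set z | A (k * z + d)].
Proof.
move=> k0 tA a b c bc; apply: sub_countable (tA (k * a + d) (k * b) (k * c) _).
  apply: subset_card_le => t /=; congr A.
  by rewrite /parabola !mulrDr !(mulrCA k); ring.
by rewrite invfM mulrACA divff // mul1r.
Qed.

(** The kernel of a nonzero real linear form is a real line. *)
Lemma re_form_indep g b c : g != 0 -> c / b \isn't Num.real ->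
  re_form g b = 0 -> re_form g c = 0 -> False.
Proof.
move=> g0 bc B0 C0; case/negP: bc.
have [->|b0] := eqVneq b 0; first by rewrite invr0 mulr0 rpred0.
have -> : c / b = (g * c) / (g * b) by rewrite invfM mulrACA divff // mul1r.
have u0 : g * b != 0 by rewrite mulf_neq0.
move: B0 C0 u0; rewrite /re_form; case: (g * b) (g * c) => [p x] [p' y] /= B0 C0.
have -> : p = 0 by lra.
have -> : p' = 0 by lra.
move=> u0; have x0 : x != 0 by apply: contraNneq u0 => ->.
have -> : (0 +i* y) / (0 +i* x) = (y / x)%:C.
  apply: (mulIf u0); rewrite divfK //; apply/eqP; rewrite eq_complex /=.
  by apply/andP; split; apply/eqP; field.
by rewrite complex_real.
Qed.

Lemma re_form_parabola g a b c t : re_form g (parabola a b c t) =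
  re_form g a + t * re_form g b + t ^+ 2 * re_form g c.
Proof. by rewrite !re_formD !re_formZ. Qed.

(** On the parabola the linear form is a polynomial of degree at most 2 in [t],
    not constant because a nonzero form cannot vanish at both [b] and [c]. *)
Lemma thin_line g (r : R) : g != 0 -> thin [set z | re_form g z = r].
Proof.
move=> g0 a b c bc; set S := [set t | _].
have [/eqP ->|/set0P[t0 St0]] := boolP (S == set0); first exact: countable0.
apply: finite_set_countable.
apply: (@sub_finite_set _ _ ([set t0] `|` [set - re_form g b / re_form g c - t0])).
  move=> t St; have [->|tt0] := eqVneq t t0; [by left|right].
  move: St0 St; rewrite /S /= !re_form_parabola => <- /eqP.
  rewrite -subr_eq0; set B := re_form g b; set C := re_form g c.
  (* The second root is given by Vieta's formula. *)
  rewrite (_ : _ - _ = (t - t0) * (B + (t + t0) * C)); last by ring.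
  rewrite mulf_eq0 subr_eq0 (negPf tt0) /= => /eqP E.
  have C0 : C != 0.
    apply/eqP => C0; apply: (re_form_indep g0 bc _ C0).
    by move: E; rewrite C0 mulr0 addr0.
  have -> : - B = (t + t0) * C by apply/eqP; rewrite eq_sym -subr_eq0 opprK addrC E.
  by rewrite mulfK // addrK.
by rewrite finite_setU; split; apply: finite_set1.
Qed.

(** A weak form of openness that is sufficient to leave a thin set, and whose
    stability under affine preimages and intersections is immediate. *)
Definition arc_open A : Prop := forall z b c, A z ->
  exists2 e : R, 0 < e & forall t, 0 <= t < e -> A (parabola z b c t).

Lemma arc_openI A B : arc_open A -> arc_open B -> arc_open (A `&` B).
Proof.
move=> oA oB z b c [/(oA _ b c)[e e0 hA] /(oB _ b c)[e' e'0 hB]].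
exists (Num.min e e'); first by rewrite lt_min e0.
move=> t; rewrite lt_min => /and3P[t0 te te'].
by split; [apply: hA|apply: hB]; rewrite t0.
Qed.

Lemma arc_open_affine k d A : arc_open A -> arc_open [set z | A (k * z + d)].
Proof.
move=> oA z b c /(oA _ (k * b) (k * c))[e e0 he]; exists e => // t /he.
rewrite /=; congr A; by rewrite /parabola !mulrDr !(mulrCA k); ring.
Qed.

Lemma arc_open_half_plane g (r : R) : arc_open [set z | 0 < re_form g z + r].
Proof.
move=> z b c /= h; set B := re_form g b; set C := re_form g c.
set m := re_form g z + r in h.
have D0 : 0 < `|B| + `|C| + 1 by rewrite ltr_pwDr // addr_ge0.
exists (Num.min 1 (m / (`|B| + `|C| + 1))); first by rewrite lt_min ltr01 divr_gt0.
move=> t; rewrite lt_min ltr_pdivlMr // => /and3P[t0 t1 tm].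
rewrite /= re_form_parabola -/B -/C.
have hB : - (t * `|B|) <= t * B.
  by rewrite -mulrN ler_wpM2l // lerNl ler_normr lexx orbT.
have hC : - (t ^+ 2 * `|C|) <= t ^+ 2 * C.
  by rewrite -mulrN ler_wpM2l ?exprn_ge0 // lerNl ler_normr lexx orbT.
have hC' : t ^+ 2 * `|C| <= t * `|C|.
  by rewrite ler_wpM2r // expr2 ler_piMl // ltW.
move: tm; rewrite !mulrDr mulr1; rewrite /m; lra.
Qed.

(** A nondegenerate interval has positive Lebesgue measure, so it is not
    countable. *)
Lemma thin_arc_open A U z : thin A -> arc_open U -> U z ->
  exists2 w, U w & ~ A w.
Proof.
move=> tA oU Uz; apply: contrapT => nex.
have UA : U `<=` A by move=> w Uw; apply: contrapT => nAw; apply: nex; exists w.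
have [e e0 he] := oU z 1 'i Uz.
have i_nreal : 'i / 1 \isn't @Num.real R[i].
  by rewrite divr1 complex_real oner_eq0.
have /countable_lebesgue_measure0 : countable [set` `[(0 : R), e[].
  apply: sub_countable (tA z 1 'i i_nreal).
  by apply: subset_card_le => t /=; rewrite in_itv /= => /he/UA.
rewrite lebesgue_measure_itv /= lte_fin e0 -EFinB subr0 => -[] e_0.
by rewrite e_0 ltxx in e0.
Qed.

End Thin.

(** * The orbit of the boundary is thin *)

Section Boundary.
Variables (R : realType) (beta : R) (zeta eta1 eta2 xi g1 g2 : R[i]).
Hypothesis dual1 : forall x y : R, re_form g1 (x%:C * eta1 + y%:C * eta2) = x.
Hypothesis dual2 : forall x y : R, re_form g2 (x%:C * eta1 + y%:C * eta2) = y.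
Hypothesis dualK : forall z,
  z = (re_form g1 z)%:C * eta1 + (re_form g2 z)%:C * eta2.
Hypothesis bz_neq0 : beta%:C * zeta != 0.

Local Notation lat := (rb_lattice eta1 eta2).
Local Notation dom := (rb_domain eta1 eta2 xi).
Local Notation odom := (open_domain xi g1 g2).
Local Notation digit := (rb_digit beta zeta eta1 eta2 xi).
Local Notation T := (rb_map beta zeta eta1 eta2 xi).
Local Notation bdry := (rb_boundary eta1 eta2 xi).

Lemma near_form_lt (g z : R[i]) (r : R) : re_form g z < r ->
  \forall w \near (z : R[i]^o), re_form g w < r.
Proof.
move=> zr; have D0 : 0 < 2 * `|g| + 1 :> R[i].
  by rewrite ltr_wpDl // mulr_ge0.
have e0 : 0 < (r - re_form g z)%:C / (2 * `|g| + 1).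
  by rewrite divr_gt0 // ltcR subr_gt0.
apply/nbhs_ballP; exists ((r - re_form g z)%:C / (2 * `|g| + 1)) => //= w.
rewrite -ball_normE /= ltr_pdivlMr // => zw.
have : `|re_form g (w - z)|%:C < (r - re_form g z)%:C.
  apply: le_lt_trans (re_form_le _ _) _; apply: le_lt_trans zw.
  by rewrite mulrC distrC ler_wpM2l // lerDl.
by rewrite ltcR re_formB => /(le_lt_trans (ler_norm _)); lra.
Qed.

Lemma near_form_gt (g z : R[i]) (r : R) : r < re_form g z ->
  \forall w \near (z : R[i]^o), r < re_form g w.
Proof.
move=> zr; have := @near_form_lt (- g) z (- r).
rewrite re_formNl ltrN2 => /(_ zr); apply: filterS => w.
by rewrite re_formNl ltrN2.
Qed.

Lemma domain_closure z : closure (dom : set R[i]^o) z ->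
  0 <= re_form g1 (z - xi) <= 1 /\ 0 <= re_form g2 (z - xi) <= 1.
Proof.
move=> cz.
have key g : (forall w, dom w -> 0 <= re_form g (w - xi) < 1) ->
    0 <= re_form g (z - xi) <= 1.
  move=> hg; apply/andP; split; rewrite leNgt; apply/negP; rewrite re_formB => h.
    have /(near_form_lt)/cz[w []] : re_form g z < re_form g xi by lra.
    by move=> /hg; rewrite re_formB => /andP[? ?] /=; lra.
  have /(near_form_gt)/cz[w []] : 1 + re_form g xi < re_form g z by lra.
  by move=> /hg; rewrite re_formB => /andP[? ?] /=; lra.
by split; apply: key => w /(domainP xi dual1 dual2 dualK)[].
Qed.

Lemma open_domain_interior : odom `<=` interior (dom : set R[i]^o).
Proof.
move=> z; rewrite /open_domain /= !re_formB => -[/andP[a b] /andP[c d]].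
have h1 : re_form g1 xi < re_form g1 z by lra.
have h2 : re_form g1 z < 1 + re_form g1 xi by lra.
have h3 : re_form g2 xi < re_form g2 z by lra.
have h4 : re_form g2 z < 1 + re_form g2 xi by lra.
suff : \forall w \near (z : R[i]^o), dom w by [].
near=> w; apply/(domainP xi dual1 dual2 dualK).
have w1 : re_form g1 xi < re_form g1 w by near: w; exact: near_form_gt.
have w2 : re_form g1 w < 1 + re_form g1 xi by near: w; exact: near_form_lt.
have w3 : re_form g2 xi < re_form g2 w by near: w; exact: near_form_gt.
have w4 : re_form g2 w < 1 + re_form g2 xi by near: w; exact: near_form_lt.
by rewrite !re_formB; split; apply/andP; split; lra.
Unshelve. all: by end_near. Qed.

Lemma thin_boundary : thin bdry.
Proof.
have g10 : g1 != 0.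
  apply/eqP => g0; have := dual1 1 0; rewrite g0 /re_form mul0r /= mulr0 => /eqP.
  by rewrite eq_sym oner_eq0.
have g20 : g2 != 0.
  apply/eqP => g0; have := dual2 0 1; rewrite g0 /re_form mul0r /= mulr0 => /eqP.
  by rewrite eq_sym oner_eq0.
pose side (p : bool * bool) := [set z | re_form (if p.1 then g1 else g2) z =
  re_form (if p.1 then g1 else g2) xi + p.2%:R].
have tside : thin (\bigcup_p side p).
  by apply: thin_bigcup => -[[] b]; apply: thin_line.
apply: thin_sub tside => z [/domain_closure + nz].
rewrite !re_formB => -[/andP[a b] /andP[c d]].
have [E|n1] := eqVneq (re_form g1 z) (re_form g1 xi + false%:R).
  by exists (true, false).
have [E|n2] := eqVneq (re_form g1 z) (re_form g1 xi + true%:R).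
  by exists (true, true).
have [E|n3] := eqVneq (re_form g2 z) (re_form g2 xi + false%:R).
  by exists (false, false).
have [E|n4] := eqVneq (re_form g2 z) (re_form g2 xi + true%:R).
  by exists (false, true).
case: nz; apply: open_domain_interior; rewrite /open_domain /= !re_formB.
rewrite /= ?addr0 in n1 n2 n3 n4.
have m1 : re_form g1 z - re_form g1 xi != 0 by rewrite subr_eq0.
have m2 : re_form g1 z - re_form g1 xi != 1 by rewrite subr_eq addrC.
have m3 : re_form g2 z - re_form g2 xi != 0 by rewrite subr_eq0.
have m4 : re_form g2 z - re_form g2 xi != 1 by rewrite subr_eq addrC.
by rewrite !lt_neqAle a b c d m2 m4 eq_sym m1 eq_sym m3.
Qed.

(** A point of the domain with a zero coordinate is not interior: moving it
    slightly along the opposite of the basis vector leaves the domain. *)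
Lemma interior_domain : dom `\` bdry `<=` odom.
Proof.
move=> z [dz nbz].
have iz : interior (dom : set R[i]^o) z.
  apply: contrapT => niz; apply: nbz; split=> //.
  exact: (@subset_closure (R[i]^o)).
have pos g e : (forall w, dom w -> 0 <= re_form g (w - xi)) ->
    re_form g e = 1 -> 0 < re_form g (z - xi).
  move=> dg ge; rewrite lt_neqAle dg // andbT; apply/eqP => z0.
  have D0 : 0 < `|e| + 1 :> R[i] by rewrite ltr_wpDl.
  move: iz => /nbhs_ballP[d /= d0 dd].
  pose r := complex.Re (d / (`|e| + 1)) / 2.
  have rE : (complex.Re (d / (`|e| + 1)))%:C = d / (`|e| + 1).
    by rewrite RRe_real // ger0_real // ltW // divr_gt0.
  have r0 : 0 < complex.Re (d / (`|e| + 1)) by rewrite -ltcR rE divr_gt0.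
  have /dd/dg : ball (z : R[i]^o) d (z - r%:C * e).
    rewrite -ball_normE /= opprB addrC subrK normrM.
    have -> : `|r%:C| = r%:C by rewrite ger0_norm // ler0c /r divr_ge0 // ltW.
    have : r%:C < d / (`|e| + 1) by rewrite -rE ltcR /r; lra.
    rewrite ltr_pdivlMr //; apply: le_lt_trans.
    by rewrite ler_wpM2l ?lerDl // ler0c /r divr_ge0 // ltW.
  rewrite (_ : z - r%:C * e - xi = (z - xi) - r%:C * e); last by rewrite addrAC.
  by rewrite re_formB -z0 re_formZ ge /r; lra.
have /(domainP xi dual1 dual2 dualK)[/andP[_ x1] /andP[_ x2]] := dz.
rewrite /open_domain /= x1 x2 !andbT; split.
  apply: (pos _ eta1) => [w /(domainP xi dual1 dual2 dualK)[/andP[]]//|].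
  by have := dual1 1 0; rewrite rmorph0 rmorph1 mul0r addr0 mul1r.
apply: (pos _ eta2) => [w /(domainP xi dual1 dual2 dualK)[_ /andP[]]//|].
by have := dual2 0 1; rewrite rmorph0 rmorph1 mul0r add0r mul1r.
Qed.

Lemma near_int_eq (x : R) :
  (forall e : R, 0 < e -> exists m : int, `|x - m%:~R| < e) ->
  exists m : int, x = m%:~R.
Proof.
move=> hx; exists (Num.floor x); apply: contrapT => /eqP nx.
have /andP[fx xf] := floor_itv x; rewrite intrD in xf.
have {}fx : (Num.floor x)%:~R < x by rewrite lt_neqAle eq_sym nx.
have [|m] := hx (Num.min (x - (Num.floor x)%:~R) ((Num.floor x)%:~R + 1 - x)).
  by rewrite lt_min !subr_gt0 fx.
rewrite lt_min !ltr_norml => /andP[/andP[_ h] /andP[h' _]].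
have : (Num.floor x)%:~R < m%:~R :> R by lra.
have : m%:~R < (Num.floor x)%:~R + 1%:~R :> R by lra.
by rewrite -intrD !ltr_int; lia.
Qed.

(** The lattice is closed, so the limit of [beta zeta z' - d(z')] as [z'] tends
    to [z] still differs from [beta zeta z] by an element of the lattice. *)
Lemma perturbed_image_lattice eta z w :
  rb_perturbed_image beta zeta eta1 eta2 xi eta z w ->
  lat (beta%:C * zeta * z - w).
Proof.
move=> lim.
have approx g : (forall d, lat d -> exists m : int, re_form g d = m%:~R) ->
    exists m : int, re_form g (beta%:C * zeta * z - w) = m%:~R.
  move=> glat; apply: near_int_eq => e e0.
  pose e' : R := e / 2.
  have e'0 : 0 < e' by rewrite divr_gt0.
  pose K := 2 * `|g| + 1 : R[i].
  have K0 : 0 < K by rewrite ltr_wpDl // mulr_ge0.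
  have ek : 0 < e'%:C / K by rewrite divr_gt0 // ltcR.
  pose B := re_form g (beta%:C * zeta * eta).
  have B0 : 0 < `|B| + 1 by rewrite ltr_wpDl.
  move/cvgrPdist_lt : lim => /(_ _ ek) lim.
  have small : \forall t \near (0 : R)^'+, 0 < t < e' / (`|B| + 1).
    near=> t; apply/andP; split; near: t; first exact: nbhs_right_gt.
    by apply: nbhs_right_lt; rewrite divr_gt0.
  have [t [/= tw /andP[t0 tB]]] := filter_ex (filterI lim small).
  have [ld _] := digitP beta zeta xi dual1 dual2 dualK (z - t%:C * eta).
  have [m dm] := glat _ ld; exists m.
  have -> : re_form g (beta%:C * zeta * z - w) - m%:~R =
      re_form g (T (z - t%:C * eta) - w) + t * B.
    rewrite -dm /B /rb_map -re_formZ -re_formB -re_formD; congr re_form; ring.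
  apply: le_lt_trans (ler_normD _ _) _.
  have -> : e = e' + e' by rewrite /e'; field.
  apply: ltrD.
    rewrite -ltcR; apply: le_lt_trans (re_form_le _ _) _.
    rewrite ltr_pdivlMr // in tw; apply: le_lt_trans tw.
    by rewrite distrC mulrC ler_wpM2l // lerDl.
  rewrite ltr_pdivlMr // in tB; apply: le_lt_trans tB.
  by rewrite normrM gtr0_norm // ler_wpM2l ?ltW // ltrDl.
have [m Em] : exists m : int, re_form g1 (beta%:C * zeta * z - w) = m%:~R.
  by apply: approx => d /(lattice_form dual1 dual2)[m [n [? _]]]; exists m.
have [n En] : exists n : int, re_form g2 (beta%:C * zeta * z - w) = n%:~R.
  by apply: approx => d /(lattice_form dual1 dual2)[? [n [_ ?]]]; exists n.
exact: latticeP Em En.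
Unshelve. all: by end_near. Qed.

Definition lattice_point (p : int * int) : R[i] := p.1%:~R * eta1 + p.2%:~R * eta2.

(** Images are covered by the images under the countably many similarities
    [z |-> beta zeta z - d], with [d] in the lattice. *)
Lemma thin_image A : thin A -> thin (rb_image beta zeta eta1 eta2 xi A).
Proof.
move=> tA; pose k := (beta%:C * zeta)^-1.
have k0 : k != 0 by rewrite invr_neq0.
apply: (@thin_sub _ _ (\bigcup_p [set w | A (k * w + k * lattice_point p)]));
    last first.
  by apply: thin_bigcup => p; apply: thin_affine.
move=> w Aw; suff [z [m [n E]] Az] : exists2 z, lat (beta%:C * zeta * z - w) & A z.
  exists (m, n) => //=; rewrite -mulrDr /lattice_point /= -E addrC subrK.
  by rewrite /k mulKf.
case: Aw => [[|[z [Az _] lim]]|[z [Az _] lim]]; last 2 first.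
- by exists z => //; apply: perturbed_image_lattice lim.
- by exists z => //; apply: perturbed_image_lattice lim.
move=> [z [Az _] <-]; exists z => //.
by rewrite /rb_map opprB addrC subrK; case: (digitP beta zeta xi dual1 dual2 dualK z).
Qed.

Lemma thin_preimage A : thin A -> thin (T @^-1` A).
Proof.
move=> tA.
apply: (@thin_sub _ _
  (\bigcup_p [set z | A (beta%:C * zeta * z - lattice_point p)])); last first.
  by apply: thin_bigcup => p; apply: thin_affine.
move=> z Az; have [[m [n E]] _] := digitP beta zeta xi dual1 dual2 dualK z.
by exists (m, n) => //=; rewrite /lattice_point /= -E.
Qed.

Lemma thin_orbit_boundary :
  thin (\bigcup_(n : int) rb_power beta zeta eta1 eta2 xi n bdry).
Proof.
apply: thin_bigcup => -[k|k] /=.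
  by elim: k => [|k IHk] /=; [exact: thin_boundary|exact: thin_image].
apply: (@thin_sub _ _ (iter k.+1 T @^-1` bdry)) => [z []//|].
elim: k.+1 => [|{}k IHk]; first exact: thin_boundary.
have -> : iter k.+1 T @^-1` bdry = T @^-1` (iter k T @^-1` bdry).
  by apply/seteqP; split => z; rewrite /preimage /= -iterSr.
exact: thin_preimage.
Qed.

End Boundary.

(** * Admissible words and nonempty cells *)

Section Admissible.
Variables (R : realType) (beta : R) (zeta eta1 eta2 xi g1 g2 : R[i]).
Hypothesis dual1 : forall x y : R, re_form g1 (x%:C * eta1 + y%:C * eta2) = x.
Hypothesis dual2 : forall x y : R, re_form g2 (x%:C * eta1 + y%:C * eta2) = y.
Hypothesis dualK : forall z,
  z = (re_form g1 z)%:C * eta1 + (re_form g2 z)%:C * eta2.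
Hypothesis bz_neq0 : beta%:C * zeta != 0.

Local Notation lat := (rb_lattice eta1 eta2).
Local Notation dom := (rb_domain eta1 eta2 xi).
Local Notation odom := (open_domain xi g1 g2).
Local Notation digit := (rb_digit beta zeta eta1 eta2 xi).
Local Notation T := (rb_map beta zeta eta1 eta2 xi).
Local Notation bdry := (rb_boundary eta1 eta2 xi).
Local Notation expansion := (rb_expansion beta zeta eta1 eta2 xi).
Local Notation admissible := (rb_admissible beta zeta eta1 eta2 xi).
Local Notation celld := (cell beta zeta odom).
Local Notation step := (cell_step beta zeta odom).

Definition domain_sides : seq (R[i] * R) :=
  [:: (g1, - re_form g1 xi); (- g1, 1 + re_form g1 xi);
      (g2, - re_form g2 xi); (- g2, 1 + re_form g2 xi)].

Lemma open_domain_half_planes :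
  odom = [set z | forall h, h \in domain_sides -> half_plane h z].
Proof.
apply/seteqP; split => z; rewrite /open_domain /= !re_formB.
  move=> [/andP[a b] /andP[c d]] h; rewrite !inE.
  by case/or4P => /eqP ->; rewrite /half_plane /= ?re_formNl; lra.
move=> hz; have := hz (g1, - re_form g1 xi); have := hz (- g1, 1 + re_form g1 xi).
have := hz (g2, - re_form g2 xi); have := hz (- g2, 1 + re_form g2 xi).
rewrite /half_plane /= !re_formNl !inE !eqxx !orbT.
by move=> /(_ isT) a /(_ isT) b /(_ isT) c /(_ isT) d; split; apply/andP; split; lra.
Qed.

Lemma open_domain_arc_open : arc_open odom.
Proof.
rewrite open_domain_half_planes; elim: domain_sides => [|h s IHs].
  by move=> z b c _; exists 1.
have -> : [set z | forall k, k \in h :: s -> half_plane k z] =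
    half_plane h `&` [set z | forall k, k \in s -> half_plane k z].
  apply/seteqP; split => z /=.
    by move=> hz; split=> [|k ks]; apply: hz; rewrite inE ?eqxx ?ks ?orbT.
  by move=> [hz sz] k; rewrite inE => /predU1P[->|/sz].
by apply: arc_openI => //; apply: arc_open_half_plane.
Qed.

Lemma admissible_cell u : admissible u -> celld u !=set0.
Proof.
move=> [z [dz nz] [n ->]].
have orbit_odom k : odom (iter k T z).
  apply: (@interior_domain R eta1 eta2 xi) => //; split.
    by case: k => [|k] //=; case: (digitP beta zeta xi dual1 dual2 dualK (iter k T z)).
  case: k => [|k] bk; apply: nz; first by exists 0.
  by exists (Negz k).
exists (iter (n + size u) T z).
elim: (size u) => [|m IHm]; first exact: orbit_odom.
rewrite -addn1 iotaD map_cat cats1 cell_rcons add0n addnA addn1; split=> //.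
by exists (iter (n + m) T z).
Qed.

(** Seen from the starting point rather than from the arrival point: [itinerary u]
    is the inverse image of [cell u] along [u]. *)
Fixpoint itinerary (u : seq R[i]) : set R[i] :=
  if u is a :: u' then
    odom `&` [set z | itinerary u' (beta%:C * zeta * z - a)]
  else odom.

Lemma itinerary_arc_open u : arc_open (itinerary u).
Proof.
elim: u => [|a u IHu] /=; first exact: open_domain_arc_open.
by apply: arc_openI; [exact: open_domain_arc_open|exact: arc_open_affine].
Qed.

Lemma itinerary_sub u : itinerary u `<=` odom.
Proof. by case: u => [|a u] z //= []. Qed.

Lemma itinerary_expansion u z : (forall a, a \in u -> lat a) -> itinerary u z ->
  u = [seq expansion z i | i <- iota 0 (size u)].
Proof.
elim: u z => //= a u IHu z lu [_ iz].
have la : lat a by apply: lu; rewrite mem_head.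
have dz : digit z = a.
  apply: (digit_unique dual1 dual2 dualK) => //.
  exact: open_domain_sub dual1 dual2 dualK _ (itinerary_sub iz).
rewrite {1}/rb_expansion /= dz; congr cons.
have Tz : T z = beta%:C * zeta * z - a by rewrite /rb_map dz.
rewrite -[1%N]addn0 iotaDl -map_comp [LHS](IHu (T z)) ?Tz //; last first.
  by move=> b bu; apply: lu; rewrite inE bu orbT.
by apply: eq_map => i /=; rewrite /rb_expansion iterSr Tz.
Qed.

Lemma cell_itinerary u U w : U `<=` odom -> foldl step U u w ->
  exists2 z, U z & itinerary u z.
Proof.
elim: u U => [|a u IHu] U Ud /=; first by move=> Uw; exists w => //; apply: Ud.
have sd : step U a `<=` odom by move=> z [].
move=> /(IHu _ sd)[_ [_ [z Uz ->]] iz]; exists z => //; split=> //.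
exact: Ud.
Qed.

Lemma cell_admissible u :
  (forall a, a \in u -> lat a) -> celld u !=set0 -> admissible u.
Proof.
move=> lu [w /(cell_itinerary (@subset_refl _ _))[z0 _ iz0]].
have tbad := thin_orbit_boundary xi dual1 dual2 dualK bz_neq0.
have [z iz nz] := thin_arc_open tbad (@itinerary_arc_open u) iz0.
exists z.
  by split=> //; apply: open_domain_sub dual1 dual2 dualK _ (itinerary_sub iz).
by exists 0%N; rewrite [LHS](itinerary_expansion lu iz).
Qed.

End Admissible.

(** * Symbolic dynamics *)

Lemma sofic_labelled_graph (L Q : choiceType) (A : set L) (V : set Q)
    (edge : Q -> L -> Q -> Prop) :
  finite_set A -> finite_set V ->
  sofic A [set w | exists q : int -> Q, forall j,
    [/\ V (q j), A (w j) & edge (q j) (w j) (q (j + 1))]].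
Proof.
move=> /finite_seqP[sA ->] /finite_seqP[sV ->].
pose Vt : finType := seq_sub sV.
pose Et : finType :=
  {e : Vt * seq_sub sA * Vt | `[< edge (val e.1.1) (val e.1.2) (val e.2) >]}.
exists Vt, Et, (fun e => (val e).1.1), (fun e => (val e).2), (fun e => val (val e).1.2).
split=> [e|w]; first exact: (valP (val e).1.2).
split=> [[q hq]|[p [p_path p_lab]]]; last first.
  exists (fun j => val (val (p j)).1.1) => j; rewrite -p_lab -p_path; split.
  - exact: (valP (val (p j)).1.1).
  - exact: (valP (val (p j)).1.2).
  - by have /asboolP := valP (p j).
have /choice[p hp] : forall j, exists e : Et,
    [/\ val (val e).1.1 = q j, val (val e).1.2 = w j & val (val e).2 = q (j + 1)].
  move=> j; have [Vj Aj ej] := hq j; have [Vj1 _ _] := hq (j + 1).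
  pose e : Vt * seq_sub sA * Vt := (SeqSub Vj, SeqSub Aj, SeqSub Vj1).
  have eP : `[< edge (val e.1.1) (val e.1.2) (val e.2) >] by apply/asboolP.
  by exists (exist _ e eP).
exists p; split=> j; last by case: (hp j).
by apply: val_inj; have [_ _ ->] := hp j; have [-> _ _] := hp (j + 1).
Qed.

(** Take a member of the sequence that contains as few members of the family as
    possible. *)
Lemma decreasing_eventually_constant (T : Type) (F : set (set T)) (A_ : nat -> set T) :
  finite_set F -> (forall n, F (A_ n)) -> (forall n, A_ n.+1 `<=` A_ n) ->
  exists n, forall m, (n <= m)%N -> A_ m = A_ n.
Proof.
move=> /finite_seqP[s ->] As dec.
have dec' n m : (n <= m)%N -> A_ m `<=` A_ n.
  move=> /subnK <-; elim: (m - n)%N => [|k IHk] //.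
  by rewrite addSn => x /dec /IHk.
pose J n : {set seq_sub s} :=
  [set B : seq_sub s | `[< (val B : set T) `<=` A_ n >]]%SET.
have ex_card : exists k, `[< exists n, #|J n| = k >].
  by exists #|J 0%N|; apply/asboolP; exists 0%N.
have [_ /asboolP[n <-] min_n] := ex_minnP ex_card.
exists n => m nm; apply: contrapT => ne.
have : (#|J n| <= #|J m|)%N by apply: min_n; apply/asboolP; exists m.
have inJ (B : seq_sub s) k : reflect ((val B : set T) `<=` A_ k) (B \in J k).
  by rewrite finset.in_set; apply: asboolP.
apply/negP; rewrite -ltnNge; apply/proper_card/properP; split.
  by apply/fintype.subsetP => B /inJ BA; apply/inJ => x /BA; apply: dec'.
exists (SeqSub (As n)); first exact/inJ.
by apply/inJ => /= nA; apply: ne; apply/seteqP; split=> //; apply: dec'.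
Qed.

(** * The shift space *)

Section ShiftSpace.
Variables (R : realType) (beta : R) (zeta eta1 eta2 xi g1 g2 : R[i]).
Hypothesis dual1 : forall x y : R, re_form g1 (x%:C * eta1 + y%:C * eta2) = x.
Hypothesis dual2 : forall x y : R, re_form g2 (x%:C * eta1 + y%:C * eta2) = y.
Hypothesis dualK : forall z,
  z = (re_form g1 z)%:C * eta1 + (re_form g2 z)%:C * eta2.
Hypothesis bz_neq0 : beta%:C * zeta != 0.

Local Notation odom := (open_domain xi g1 g2).
Local Notation Alph := (rb_alphabet beta zeta eta1 eta2 xi).
Local Notation celld := (cell beta zeta odom).
Local Notation step := (cell_step beta zeta odom).

Definition cells : set (set R[i]) :=
  [set celld u | u in [set u : seq R[i] | forall a, a \in u -> Alph a]].

Hypothesis cells_finite : finite_set cells.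

Let block (w : int -> R[i]) (j : int) (n : nat) :=
  [seq w (j + i%:Z) | i <- iota 0 n].

Lemma block_rcons w j n : block w j n.+1 = rcons (block w j n) (w (j + n%:Z)).
Proof. by rewrite /block -addn1 iotaD map_cat cats1 add0n. Qed.

Lemma block_cons w j n : block w j n.+1 = w j :: block w (j + 1) n.
Proof.
rewrite /block /= addr0; congr cons.
rewrite -[1%N]addn0 iotaDl -map_comp; apply: eq_map => i /=.
by rewrite PoszD addrA.
Qed.

Lemma alphabet_lattice a : Alph a -> rb_lattice eta1 eta2 a.
Proof. by move=> [z _ <-]; case: (digitP beta zeta xi dual1 dual2 dualK z). Qed.

(** From a word to a path, the vertex at time [j] is the eventual cell of the
    past of [j]. From a path to a word, the vertex [q j] is included in the open
    domain, so the vertex reached after a block is included in the cell of that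
    block, which is therefore nonempty. *)
Lemma shift_space_paths : rb_shift_space beta zeta eta1 eta2 xi =
  [set w | exists q : int -> set R[i], forall j,
    [/\ (cells `&` [set U | U !=set0]) (q j), Alph (w j) &
        q (j + 1) = step (q j) (w j)]].
Proof.
apply/seteqP; split => w.
  move=> [wA wadm].
  pose past j n := celld (block w (j - n%:Z) n).
  have cells_past j n : cells (past j n).
    by exists (block w (j - n%:Z) n) => // a /mapP[i _ ->].
  have past_neq0 j n : past j n !=set0.
    case: n => [|n].
      exists (xi + (2^-1)%:C * eta1 + (2^-1)%:C * eta2).
      exact: open_domain_center.
    apply: (admissible_cell dual1 dual2 dualK).
    have := wadm (j - n.+1%:Z) (j - 1); rewrite (_ : `|_|%N.+1 = n.+1); last lia.
    by apply; lia.
  have past_dec j n : past j n.+1 `<=` past j n.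
    rewrite /past block_cons (_ : j - n.+1%:Z + 1 = j - n%:Z); last lia.
    exact: cell_cons_sub.
  have past_step j n : past (j + 1) n.+1 = step (past j n) (w j).
    rewrite /past block_rcons cell_rcons (_ : j + 1 - n.+1%:Z = j - n%:Z); last lia.
    by rewrite subrK.
  have /choice[N hN] : forall j, exists n, forall m, (n <= m)%N -> past j m = past j n.
    move=> j; exact: (decreasing_eventually_constant cells_finite).
  exists (fun j => past j (N j)) => j; split=> //.
    by split; [exact: cells_past|exact: past_neq0].
  pose m := maxn (N j) (N (j + 1)).
  transitivity (past (j + 1) m.+1).
    by rewrite hN // ltnW // ltnS leq_maxr.
  by rewrite past_step hN // leq_maxl.
move=> [q hq]; split=> [j|j k jk]; first by case: (hq j).
rewrite -/(block w j _); set n := `|k - j|%N.+1.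
apply: (cell_admissible dual1 dual2 dualK bz_neq0).
  by move=> a /mapP[i _ ->]; apply: alphabet_lattice; case: (hq (j + i%:Z)).
have qE : q (j + n%:Z) = foldl step (q j) (block w j n).
  elim: n => [|m IHm]; first by rewrite addr0.
  rewrite block_rcons -cats1 foldl_cat /= -IHm.
  by case: (hq (j + m%:Z)) => _ _ <-; congr q; lia.
have [[_ [z qz]] _ _] := hq (j + n%:Z); exists z.
move: qz; rewrite qE; apply: foldl_cell_mono.
have [[[u _ <-] _] _ _] := hq j.
by elim/last_ind: u => [|u a _] // y; rewrite cell_rcons => -[].
Qed.

Lemma sofic_of_finite_cells : rb_sofic beta zeta eta1 eta2 xi.
Proof.
rewrite /rb_sofic shift_space_paths.
apply: (@sofic_labelled_graph _ _ _ _ (fun U a U' => U' = step U a)).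
  exact: alphabet_finite dual1 dual2 dualK.
exact: finite_setIl.
Qed.

End ShiftSpace.

(** * Soficness of the rotational beta transformation *)

Theorem theorem1p5 (R : realType) (q : nat) (zeta : R[i]) (beta : R)
    (eta1 eta2 xi : R[i])
    (q_gt2 : (2 < q)%N) (zeta_root : q.-unity_root zeta)
    (zeta_nreal : zeta \isn't Num.real)
    (beta_pisot : pisot beta)
    (eta1_in : generated_field [:: zeta; beta%:C] eta1)
    (eta2_in : generated_field [:: zeta; beta%:C] eta2)
    (xi_in : generated_field [:: zeta; beta%:C] xi)
    (eta_indep : eta1 / eta2 \isn't Num.real)
    (zeta_trace : generated_field [:: beta%:C] (zeta + zeta^-1)) :
  rb_sofic beta zeta eta1 eta2 xi.
Proof.
have [beta_int beta_gt1 _] := beta_pisot.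
have q_gt0 : (0 < q)%N by apply: leq_trans q_gt2.
have zq : zeta ^+ q = 1 by apply/unity_rootP.
have z0 : zeta != 0.
  by apply: contra_eq_neq zq => ->; rewrite expr0n gtn_eqF // eq_sym oner_neq0.
have b0 : 0 < beta by apply: lt_trans beta_gt1.
have bz0 : beta%:C * zeta != 0 by rewrite mulf_neq0 // fmorph_eq0 gt_eqF.
set K := generated_field [:: zeta; beta%:C] in eta1_in eta2_in xi_in.
have Kc : divring_closed (mem K) by exact: generated_field_closed.
have [[K0 K1 KD KB] [KM KV Kd]] := divring_closed_setP Kc.
have Kre := generated_field_Re2 q_gt0 zeta_root beta_int zeta_trace.
have [g1 [g2 [Kg1 Kg2 dual1 dual2 dualK]]] :=
  dual_basis Kc (generated_field_conj q_gt0 zeta_root) eta1_in eta2_in eta_indep.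
have KN x : K x -> K (- x) by move=> Kx; rewrite -sub0r; apply: KB.
have Kn (n : nat) : K n%:R by elim: n => // n IHn; rewrite -natr1; apply: KD.
have Kint (n : int) : K n%:~R.
  case: n => n; first exact: Kn.
  by change (K (- n.+1%:R)); apply: (KN).
have Kz : K zeta by apply: generated_field_gen; rewrite mem_head.
pose A := rb_alphabet beta zeta eta1 eta2 xi.
have A_finite : finite_set A by exact: alphabet_finite dual1 dual2 dualK.
have KA a : A a -> K a.
  move=> /(alphabet_lattice dual1 dual2 dualK)[m [n ->]].
  by apply: (KD); apply: (KM).
(* The directions of the sides of the domain, turned by the powers of zeta. *)
pose G := [set zeta ^+ r * g | r in `I_q & g in [set` [:: g1; - g1; g2; - g2]]].
have G_finite : finite_set G by apply: finite_image2.
have KG g : G g -> K g.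
  move=> [r _ [g' g'_in <-]]; apply: (KM).
    by elim: r => // r IHr; rewrite exprS; apply: (KM).
  by move: g'_in; rewrite /= !inE => /or4P[]/eqP -> //; apply: (KN).
have G_turn g : G g -> G (g / zeta).
  move=> [[|r] /= rq [g' g'_in <-]].
    exists q.-1; first by rewrite /= ltn_predL.
    exists g' => //; rewrite expr0 mul1r mulrC; congr (_ * _).
    by apply: (mulfI z0); rewrite -exprS prednK // zq divff.
  exists r; first by rewrite /= ltnW.
  by exists g' => //; rewrite exprS mulrAC [zeta * _]mulrC mulfK.
pose I := domain_sides xi g1 g2.
(* The constant terms of the sides of the domain, and the increments that the
   digits add to a constant term. *)
pose V := [set re_form g a | g in G & a in A] `|` [set h.2 | h in [set` I]].
have V_finite : finite_set V.
  by rewrite finite_setU; split; [exact: finite_image2|exact/finite_image/finite_seq].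
have V_poly v : V v -> exists P : {poly rat}, v = (map_poly ratr P).[beta].
  case=> [[g /KG Kg [a /KA Ka <-]]|[h hI <-]]; first exact: Kre (KM _ _ Kg Ka).
  have form g : K g ->
      exists P : {poly rat}, re_form g xi = (map_poly ratr P).[beta].
    by move=> Kg; exact: Kre (KM _ _ Kg xi_in).
  have formN g : K g ->
      exists P : {poly rat}, - re_form g xi = (map_poly ratr P).[beta].
    by move=> /KN/form; rewrite re_formNl.
  have form1 g : K g ->
      exists P : {poly rat}, 1 + re_form g xi = (map_poly ratr P).[beta].
    move=> /form[P ->]; exists (1 + P).
    by rewrite rmorphD rmorph1 /= hornerD hornerC.
  move: hI; rewrite /= !inE => /or4P[]/eqP -> /=;
    [exact: formN|exact: form1|exact: formN|exact: form1].
have [W [VW W_expand W_finite]] := pisot_finite_orbit beta_pisot V_finite V_poly.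
apply: (sofic_of_finite_cells dual1 dual2 dualK bz0).
apply: (@finite_cells _ _ _ _ b0 z0 A G W [set` I]) => //.
- by move=> b g a Wb Gg Aa; apply: W_expand => //; left; exists g => //; exists a.
- move=> h hI; split; last by apply: VW; right; exists h.
  exists 0%N => //; exists h.1; last by rewrite mul1r.
  by move: hI; rewrite /= !inE => /or4P[]/eqP -> /=; rewrite eqxx ?orbT.
- exact: open_domain_half_planes.
move=> g; have [C hC] := form_bounded eta1 eta2 xi g; exists C => z.
by move=> /(open_domain_sub dual1 dual2 dualK); apply: hC.
Qed.
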